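(* Let $G$ be a maximal planar graph of order $n \geq 4$. Then \[{\rm rad}(G)-\pi(G) \leq \frac{n+1}{12}+\frac{4}{3} +\frac{27}{4(n-1)}.\]
   Context: All graphs are finite, simple and connected. The order of a graph is its number of vertices. For a connected graph $G$ of order $n\ge 2$ with vertex set $V$ and shortest-path distance $d$, the average distance of a vertex $v$ is $\overline{\sigma}(v)=\frac{1}{n-1}\sum_{w\in V} d(v,w)$. The proximity of $G$ is $\pi(G)=\min_{v\in V}\overline{\sigma}(v)$. The eccentricity of $v$ is $\max_{w\in V} d(v,w)$, and the radius ${\rm rad}(G)$ is the minimum eccentricity over all vertices. A maximal planar graph is a planar graph which is no longer planar after addition of any edge. *)

(* Defs.v *)
From HB Require Import structures.
From mathcomp Require Import all_boot all_order all_algebra.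
From mathcomp Require Import all_classical all_reals all_analysis.
Set Implicit Arguments.
Unset Strict Implicit.
Unset Printing Implicit Defensive.
Import Order.TTheory GRing.Theory Num.Theory.
Import numFieldNormedType.Exports.
Local Open Scope classical_set_scope.
Local Open Scope ring_scope.

(* A finite simple graph is a symmetric irreflexive relation on a finType. *)
Definition simple_graph (T : finType) (e : rel T) : Prop :=
  symmetric e /\ irreflexive e.

Definition connected_graph (T : finType) (e : rel T) : Prop :=
  forall x y : T, connect e x y.

Definition add_edge (T : finType) (e : rel T) (x y : T) : rel T :=
  [rel u v | [|| e u v, (u == x) && (v == y) | (u == y) && (v == x)]].

Definition walk (T : finType) (e : rel T) (k : nat) (x y : T) : bool :=
  [exists p : k.-tuple T, path e x p && (last x p == y)].

(* The least k with a walk of length k from x to y; two vertices in the same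
   component are joined by a walk of length < #|T|, so the search over
   0, ..., #|T| - 1 fails (with value #|T|) only across components. *)
Definition graph_dist (T : finType) (e : rel T) (x y : T) : nat :=
  find (fun k => walk e k x y) (iota 0 #|T|).

Definition eccentricity (T : finType) (e : rel T) (v : T) : nat :=
  (\max_(w : T) graph_dist e v w)%N.

(* In a connected graph all distances are < #|T|, so for nonempty T the default
   value #|T| does not affect the minimum, here and in proximity. *)
Definition graph_radius (T : finType) (e : rel T) : nat :=
  \big[minn/#|T|]_(v : T) eccentricity e v.

Definition avg_dist (R : realType) (T : finType) (e : rel T) (v : T) : R :=
  (#|T|%:R - 1)^-1 * \sum_(w : T) (graph_dist e v w)%:R.

Definition proximity (R : realType) (T : finType) (e : rel T) : R :=
  \big[Num.min/#|T|%:R]_(v : T) avg_dist R e v.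

Definition is_arc (R : realType) (a b : R * R) (A : set (R * R)) : Prop :=
  exists f : R -> R * R,
    [/\ {within `[0, 1], continuous f},
        {in `[0, 1] &, injective f},
        f 0 = a, f 1 = b & A = f @` `[0, 1]].

(* A drawing places vertex x at the point pos x and draws the edge xy, as an
   unordered pair, along the arc [curve [set x; y]]. *)
Definition plane_drawing (R : realType) (T : finType) (e : rel T)
    (pos : T -> R * R) (curve : {set T} -> set (R * R)) : Prop :=
  [/\ injective pos,
      forall x y, e x y -> is_arc (pos x) (pos y) (curve [set x; y]%SET),
      forall x y z, e x y -> curve [set x; y]%SET (pos z) -> z = x \/ z = y &
      forall x y u v, e x y -> e u v -> [set x; y]%SET <> [set u; v]%SET ->
        curve [set x; y]%SET `&` curve [set u; v]%SET `<=`
        [set pos z | z in [set x; y] `&` [set u; v]]].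

Definition planar (R : realType) (T : finType) (e : rel T) : Prop :=
  exists pos curve, @plane_drawing R T e pos curve.

Definition maximal_planar (R : realType) (T : finType) (e : rel T) : Prop :=
  planar R e /\
  forall x y, x != y -> ~~ e x y -> ~ planar R (add_edge e x y).

(* Main.v *)
(* Let [r] be the radius, [m = n - 1], and [sigma v] the sum of the distances from
   [v].  The claim for a vertex [v] reads [sigma v >= r m - (m + 9)^2 / 12], and the
   right-hand side is at most [3 r^2 - 9 r] for every [m]; so it suffices that
   [sigma v >= 3 r^2 - 9 r].

   Combinatorially, maximality is used through one local fact: for a vertex [s],
   deleting any vertex [t] does not disconnect the graph induced on the
   neighbours of [s].  Hence a vertex of the [j]-th distance layer around [v]
   with a neighbour in the next layer has at least two neighbours of the same
   kind in its own layer.  Such vertices number at least 3, and if they are at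
   most 5 they lie within distance 2 of each other; then a vertex on a geodesic
   from [v] to one of them has eccentricity less than [r] unless [j] is small or
   large.  So the middle layers have (essentially) at least 6 vertices.

   For the local fact, the drawing is first modified so that the edges at [s]
   start with segments and both sides of each edge [sp] see [p]: the edge is
   redrawn as the image of a short segment under an injective continuous
   self-map of the plane supported in a thin tube around the old edge, and the
   neighbouring segments are carried along.  On a small circle around [s] minus
   the direction of [t], the points seeing a neighbour in a given class [P] form
   a clopen set, so by connectedness some point sees both a neighbour [p] in [P]
   and a neighbour [q] outside [P].  Unless some such pair is adjacent already,
   this yields an arc along which the edge [pq] can be added. *)
Require Import Defs.
From HB Require Import structures.
From mathcomp Require Import all_boot all_order all_algebra.
From mathcomp Require Import all_classical all_reals all_analysis.
From mathcomp Require Import ring lra zify.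
Set Implicit Arguments.
Unset Strict Implicit.
Unset Printing Implicit Defensive.
Import Order.TTheory GRing.Theory Num.Theory.
Import numFieldNormedType.Exports.
Local Open Scope classical_set_scope.
Local Open Scope ring_scope.

(** * Arcs *)

Lemma continuousP_eps (R : realType) (V W : pseudoMetricNormedZmodType R)
    (f : V -> W) :
  continuous f <->
  forall x eps, 0 < eps -> exists2 d, 0 < d &
    forall y, `|x - y| < d -> `|f x - f y| < eps.
Proof.
split=> [cf x eps e0|H x].
  have /cvgrPdist_lt/(_ _ e0) := cf x.
  move=> /nbhs_normP[d /= d0 dP]; exists d => // y xy; exact: (dP y xy).
apply/cvgrPdist_lt => eps e0; have [d d0 dP] := H x _ e0.
by apply/nbhs_normP; exists d => //= y; exact: dP.
Qed.

Lemma continuous_line (R : realType) (V : normedModType R) (a b : V) :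
  continuous (fun t : R => a + t *: b).
Proof.
move=> t; apply: cvgD; first exact: cvg_cst.
by apply: cvgZr_tmp; exact: cvg_id.
Qed.

(** The hitting times in [[0, L]] form a nonempty compact set, which has a least element. *)
Lemma first_hit (R : realType) (V : normedModType R) (f : R -> V) (K : set V) L :
  continuous f -> closed K -> 0 <= L -> K (f L) ->
  exists t0, [/\ 0 <= t0 <= L, K (f t0) &
    forall u, 0 <= u -> u < t0 -> ~ K (f u)].
Proof.
move=> cf cK L0 KL.
have cA : compact (`[0, L] `&` f @^-1` K).
  apply: compact_closedI; first exact: segment_compact.
  by move/continuous_closedP : cf; exact.
have A0 : (`[0, L] `&` f @^-1` K) !=set0.
  by exists L; split => //=; rewrite in_itv /= L0 lexx.
have [|c] := @compact_EVT_min R R id _ A0 cA.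
  by apply: continuous_subspaceT => ?; exact: cvg_id.
rewrite inE /= in_itv /= => -[c1 c2] cmin; exists c; split => // u u0 uc Ku.
have := cmin u; rewrite inE /= in_itv /= => /(_ _)/wrap[].
  split => //; rewrite u0 /=; apply: ltW; apply: lt_le_trans uc _.
  by case/andP: c1.
by move=> cu; move: (lt_le_trans uc cu); rewrite ltxx.
Qed.

Lemma image_itv_compact (R : realType) (V : normedModType R) (f : R -> V) a b :
  continuous f -> compact (f @` `[a, b]).
Proof.
move=> cf; apply: continuous_compact; last exact: segment_compact.
exact: continuous_subspaceT.
Qed.

Lemma image_itv_closed (R : realType) (V : normedModType R) (f : R -> V) a b :
  continuous f -> closed (f @` `[a, b]).
Proof.
move=> cf; apply: compact_closed; first exact: norm_hausdorff.
exact: image_itv_compact.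
Qed.

(** The length [L] is free, so reversal and concatenation need no rescaling, and [L = 0] is allowed,
    which makes the relation reflexive on [Z]. Injectivity is asked on [[0, L]] only, while [f] is
    continuous on the whole line. *)
Definition arcin (R : realType) (V : normedModType R) (Z : set V) (a b : V) :=
  exists (L : R) (f : R -> V), 0 <= L /\
    [/\ continuous f,
        forall t u, 0 <= t <= L -> 0 <= u <= L -> f t = f u -> t = u,
        f 0 = a, f L = b & forall t, 0 <= t <= L -> Z (f t)].

Section arcin.
Variables (R : realType) (V : normedModType R).
Implicit Types (Z : set V) (a b c : V).

Lemma arcin_refl Z a : Z a -> arcin Z a a.
Proof.
move=> Za; exists 0, (fun=> a); split => //; split => //.
  by move=> ?; exact: cvg_cst.
by move=> t u t0 u0 _; lra.
Qed.

Lemma sub_arcin Z Z' a b : Z `<=` Z' -> arcin Z a b -> arcin Z' a b.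
Proof.
move=> ZZ [L [f [L0 [cf fi f0 fL fZ]]]]; exists L, f; split=> //; split=> //.
by move=> t tL; apply: ZZ; exact: fZ.
Qed.

Lemma arcin_path Z (f : R -> V) u v : continuous f -> u <= v ->
  (forall t t', u <= t <= v -> u <= t' <= v -> f t = f t' -> t = t') ->
  (forall t, u <= t <= v -> Z (f t)) -> arcin Z (f u) (f v).
Proof.
move=> cf uv fi fZ; exists (v - u), (fun t => f (t + u)); split; first lra.
split.
- move=> t; apply: continuous_comp; last exact: cf.
  by apply: cvgD; [exact: cvg_id|exact: cvg_cst].
- move=> t t' t1 t'1 ff; have := fi (t + u) (t' + u).
  by move=> /(_ _ _ ff) H; have := H ltac:(lra) ltac:(lra); lra.
- by rewrite add0r.
- by rewrite subrK.
- by move=> t t1; apply: fZ; lra.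
Qed.

Lemma arcin_sym Z a b : arcin Z a b -> arcin Z b a.
Proof.
move=> [L [f [L0 [cf fi f0 fL fZ]]]].
exists L, (fun t => f (L - t)); split=> //; split.
- move=> t; apply: continuous_comp; last exact: cf.
  by apply: cvgB; [exact: cvg_cst|exact: cvg_id].
- by move=> t u tL uL /fi H; have := H ltac:(lra) ltac:(lra); lra.
- by rewrite subr0.
- by rewrite subrr.
- by move=> t tL; apply: fZ; lra.
Qed.

(* Follow the first arc until it meets the second one. *)
Lemma arcin_trans Z a b c : arcin Z a b -> arcin Z b c -> arcin Z a c.
Proof.
move=> [L [f [L0 [cf fi f0 fL fZ]]]] [M [g [M0 [cg gi g0 gM gZ]]]].
have [|t0 [t0L [s /=]]] := first_hit cf (@image_itv_closed _ _ g 0 M cg) L0.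
  by exists 0; rewrite ?g0 ?fL//= in_itv /= lexx.
rewrite in_itv /= => sM gs hit.
(* At every [t] one of the first two terms equals the junction [f t0 = g s], so this single formula
   follows [f], then [g], and is visibly continuous. *)
pose h t := f (Num.min t t0) + g (Num.max t t0 - t0 + s) - f t0.
have h1 t : t <= t0 -> h t = f t.
  by move=> tt0; rewrite /h min_l// max_r// subrr add0r gs addrK.
have h2 t : t0 <= t -> h t = g (t - t0 + s).
  by move=> tt0; rewrite /h min_r// max_l// addrC addKr.
have ch : continuous h.
  move=> t; apply: cvgB; last exact: cvg_cst.
  apply: cvgD; apply: continuous_comp; [|exact: cf| |exact: cg].
    by apply: continuous_min; [exact: cvg_id|exact: cvg_cst].
  apply: cvgD; last exact: cvg_cst.
  apply: cvgB; last exact: cvg_cst.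
  by apply: continuous_max; [exact: cvg_id|exact: cvg_cst].
have sep t u : 0 <= t -> t < t0 -> 0 <= u <= M -> f t <> g u.
  by move=> t1 t2 u1 fg; apply: (hit t t1 t2); exists u => //=; rewrite in_itv.
exists (t0 + (M - s)), h; split; first lra.
split=> //.
- move=> t u tL uL.
  case: (ltP t t0) => tt; case: (ltP u t0) => ut.
  + by rewrite !h1 ?(ltW)// => /fi; apply; lra.
  + by rewrite h1 ?(ltW)// h2// => /sep[]//; lra.
  + by rewrite (h1 u) ?(ltW)// h2// => /esym/sep[]//; lra.
  + by rewrite !h2// => /gi H; have := H ltac:(lra) ltac:(lra); lra.
- by rewrite h1//; lra.
- by rewrite h2; last lra; rewrite -gM; congr g; lra.
- move=> t tL; case: (ltP t t0) => tt.
    by rewrite h1 ?ltW//; apply: fZ; lra.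
  by rewrite h2//; apply: gZ; lra.
Qed.

Lemma arcin_seg Z a b :
  (forall t, 0 <= t <= 1 -> Z (a + t *: (b - a))) -> arcin Z a b.
Proof.
move=> H; have [<-|ab] := eqVneq a b.
  by apply: arcin_refl; have := H 0; rewrite scale0r addr0; apply; lra.
have := @arcin_path Z (fun t : R => a + t *: (b - a)) 0 1.
rewrite scale0r addr0 scale1r [a + _]addrC subrK; apply=> //.
  exact: continuous_line.
move=> t t' _ _ /addrI/eqP; rewrite -subr_eq0 -scalerBl scaler_eq0 !subr_eq0.
by rewrite (eq_sym b) (negbTE ab) orbF => /eqP.
Qed.

End arcin.

(** Precomposing with the retraction of the line onto [[0, 1]] replaces continuity within the
    segment by continuity everywhere. *)
Lemma is_arc_path (R : realType) (a b : R * R) A : is_arc a b A ->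
  exists f : R -> R * R, [/\ continuous f,
    forall t u, 0 <= t <= 1 -> 0 <= u <= 1 -> f t = f u -> t = u,
    f 0 = a, f 1 = b & A = f @` `[0, 1]].
Proof.
move=> [f [cf fi f0 f1 ->]].
pose c (t : R) := Num.max 0 (Num.min t 1).
have c01 t : 0 <= c t <= 1.
  by rewrite /c le_max lexx /= ge_max ler01 /= ge_min lexx orbT.
have cE t : 0 <= t <= 1 -> c t = t.
  by move=> /andP[t0 t1]; rewrite /c min_l// max_r.
have cc : continuous c.
  move=> t; apply: (@continuous_max R R (fun=> 0) (fun u => Num.min u 1) t).
    exact: cvg_cst.
  by apply: continuous_min; [exact: cvg_id|exact: cvg_cst].
exists (f \o c); split.
- move=> t; move/subspace_continuousP : cf => /(_ (c t)) /=.
  rewrite in_itv /= => /(_ (c01 t)) ft B /ft /=.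
  rewrite nbhs_simpl/= /within /= => H.
  have := cc t _ H; rewrite /= nbhs_simpl /=.
  apply: filterS => u /=; apply; by rewrite in_itv /= c01.
- by move=> t u t1 u1 /=; rewrite !cE// => /fi; apply; rewrite ?inE /= ?in_itv.
- by rewrite /= cE// lexx ler01.
- by rewrite /= cE// lexx ler01.
- apply/seteqP; split=> x [t /=]; rewrite in_itv /= => t1 <-;
  by exists t; rewrite /= ?in_itv//= cE.
Qed.

Lemma arcin_is_arc (R : realType) (Z : set (R * R)) a b : a <> b ->
  arcin Z a b -> exists2 A, is_arc a b A & A `<=` Z.
Proof.
move=> ab [L [f [L0 [cf fi f0 fL fZ]]]].
have {}L0 : 0 < L.
  rewrite lt_neqAle L0 andbT; apply/eqP => L0'.
  by apply: ab; rewrite -f0 -fL L0'.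
have bd t : 0 <= t <= 1 -> 0 <= t * L <= L.
  move=> /andP[t0 t1]; rewrite mulr_ge0 ?(ltW L0)//=.
  by rewrite -[leRHS]mul1r ler_wpM2r// ltW.
exists ((fun t => f (t * L)) @` `[0, 1]); last first.
  by move=> _ [t /= t1 <-]; apply: fZ; apply: bd; rewrite in_itv in t1.
exists (fun t => f (t * L)); split => //.
- apply: continuous_subspaceT => t; apply: continuous_comp; last exact: cf.
  by apply: cvgMr_tmp; exact: cvg_id.
- move=> t u; rewrite ?inE /= ?in_itv /= => t1 u1 /fi H.
  by have := H (bd _ t1) (bd _ u1); apply: mulIf; rewrite gt_eqF.
- by rewrite mul0r.
- by rewrite mul1r.
Qed.

(** * Tubes around paths *)

(** Connectedness of the line in the form of a continuous induction; it serves to push a point along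
    a path and to scan a circle. *)
Lemma locally_constant_line (R : realType) (S : R -> Prop) u :
  S u -> (forall t, exists2 d, 0 < d & forall t', `|t - t'| < d -> (S t <-> S t')) ->
  forall t, S t.
Proof.
move=> Su H t.
have : connected [set: R] by apply/connected_intervalP => a b _ _ c _.
have oS : open [set t | S t].
  rewrite openE => r /= Sr; have [d d0 dP] := H r.
  by apply/nbhs_normP; exists d => //= r' rr'; apply/(dP r').
have cS : closed [set t | S t].
  rewrite -openC openE => r /= Sr; have [d d0 dP] := H r.
  by apply/nbhs_normP; exists d => //= r' rr' Sr'; apply: Sr; apply/(dP r').
move=> /(_ [set t | S t]) H1; have : [set t | S t] = [set: R].
  apply: H1; first by exists u.
    by exists [set t | S t] => //; rewrite setTI.
  by exists [set t | S t] => //; rewrite setTI.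
by move=> /seteqP[_ /(_ t)]; exact.
Qed.

(** The distance is a positive continuous function on a compact rectangle and attains its minimum
    there. *)
Lemma path_sep (R : realType) (V : normedModType R) (f g : R -> V) a b c d :
  continuous f -> continuous g ->
  (forall t u, a <= t <= b -> c <= u <= d -> f t <> g u) ->
  exists2 eps, 0 < eps & forall t u, a <= t <= b -> c <= u <= d ->
    eps <= `|f t - g u|.
Proof.
move=> cf cg fg.
have [ab|ba] := leP a b; last by exists 1 => // t u; lra.
have [cd|dc] := leP c d; last by exists 1 => // t u _; lra.
pose A : set (R * R) := `[a, b] `*` `[c, d].
have cA : compact A by apply: compact_setX; exact: segment_compact.
have A0 : A !=set0 by exists (a, c); split; rewrite /= in_itv /= lexx.
have [|[t u]] := @compact_EVT_min _ R (fun p => `|f p.1 - g p.2|) _ A0 cA.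
  apply: continuous_subspaceT => p; apply: cvg_norm; apply: cvgB.
    by apply: (@continuous_comp _ _ _ fst f p); [exact: cvg_fst|exact: cf].
  by apply: (@continuous_comp _ _ _ snd g p); [exact: cvg_snd|exact: cg].
rewrite inE /A /= !in_itv /= => -[t1 u1] Hmin.
exists (`|f t - g u|).
  by rewrite normr_gt0 subr_eq0; apply/eqP; exact: fg.
move=> t' u' t'1 u'1; have := Hmin (t', u'); apply.
by rewrite inE /= !in_itv.
Qed.

Section tubes.
Variables (R : realType) (V : normedModType R).
Implicit Types (A : set V) (x y z a b p q : V) (f : R -> V).

Definition seg a b : set V :=
  [set z | exists2 t : R, 0 <= t <= 1 & z = a + t *: (b - a)].
Definition onbhd A eps : set V := [set z | exists2 a, A a & `|z - a| < eps].
Definition cnbhd A eps : set V := [set z | exists2 a, A a & `|z - a| <= eps].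

Lemma seg_l a b : seg a b a.
Proof. by exists 0; rewrite ?scale0r ?addr0//; lra. Qed.

Lemma seg_r a b : seg a b b.
Proof. by exists 1; rewrite ?scale1r ?[a + _]addrC ?subrK//; lra. Qed.

(** Segments from [a] that meet elsewhere lie on one ray, so the longer one contains the end of the
    shorter one. *)
Lemma seg_meet a p q z : seg a p z -> seg a q z ->
  [\/ z = a, seg a p q | seg a q p].
Proof.
move=> [t t1 zE] [u u1]; rewrite {1}zE => /addrI tu.
have [t0|t0] := eqVneq t 0.
  by apply: Or31; rewrite zE t0 scale0r addr0.
have [u0|u0] := eqVneq u 0.
  by apply: Or31; rewrite zE tu u0 scale0r addr0.
have [le|le] := leP t u.
- apply: Or32; exists (t / u).
    by rewrite divr_ge0 ?ler_pdivrMr /=; lra.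
  rewrite mulrC -scalerA tu scalerA mulVf// scale1r.
  by rewrite [a + _]addrC subrK.
- apply: Or33; exists (u / t).
    by rewrite divr_ge0 ?ler_pdivrMr /=; lra.
  rewrite mulrC -scalerA -tu scalerA mulVf// scale1r.
  by rewrite [a + _]addrC subrK.
Qed.

Lemma arcin_seg_set Z a b : seg a b `<=` Z -> arcin Z a b.
Proof. by move=> H; apply: arcin_seg => t t1; apply: H; exists t. Qed.

Lemma seg_sym a b : seg a b `<=` seg b a.
Proof.
move=> _ [t t1 ->]; exists (1 - t); first lra.
by rewrite scalerBl scale1r [RHS]addrA [b + (a - b)]addrC subrK -scalerN opprB.
Qed.

(** A homothety centred at [a] with ratio at most 1 preserves the segment and does not increase
    distances: the tube is star-shaped about [a]. *)
Lemma cnbhd_seg_star a b p eps :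
  cnbhd (seg a b) eps p -> seg a p `<=` cnbhd (seg a b) eps.
Proof.
move=> [_ [t t1 ->] tp] _ [u u1 ->].
exists (a + (u * t) *: (b - a)); first by exists (u * t) => //; nra.
have -> : a + u *: (p - a) - (a + (u * t) *: (b - a)) =
    u *: (p - (a + t *: (b - a))).
  by rewrite opprD addrACA subrr add0r [in RHS]opprD addrA [RHS]scalerBr scalerA.
rewrite normrZ ger0_norm; last by case/andP: u1.
by apply: le_trans tp; rewrite ler_piMl//; case/andP: u1.
Qed.

(** After a homothety of ratio [t] the point is within [t * eps] of the segment, which leaves a
    margin of [(1 - t) * eps]. *)
Lemma cnbhd_seg_interior a b p eps t : 0 < eps ->
  cnbhd (seg a b) eps p -> 0 <= t < 1 ->
  exists2 r, 0 < r & forall z, `|a + t *: (p - a) - z| < r -> cnbhd (seg a b) eps z.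
Proof.
move=> e0 [_ [u u1 ->] up] t1; exists ((1 - t) * eps); first by nra.
move=> z zr; exists (a + (t * u) *: (b - a)); first by exists (t * u) => //; nra.
have -> : z - (a + (t * u) *: (b - a)) =
    t *: (p - (a + u *: (b - a))) - (a + t *: (p - a) - z).
  rewrite [in RHS]opprB [in RHS]opprD [in X in _ = t *: X + _]addrA.
  rewrite [t *: (p - a - _)]scalerBr [in RHS]scalerA.
  move: (t *: (p - a)) ((t * u) *: (b - a)) => A B.
  rewrite [A - B]addrC addrACA [a + A]addrC [in RHS]opprD [A + (_ - a)]addrA.
  by rewrite subrr sub0r opprD [- a - B]addrC addrA [z - B]addrC.
rewrite (le_trans (ler_normB _ _))//.
have : `|t *: (p - (a + u *: (b - a)))| <= t * eps.
  by rewrite normrZ ger0_norm ?ler_wpM2l//; case/andP: t1.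
by move: zr; lra.
Qed.

Lemma cnbhd_closed f (u v : R) eps : continuous f -> closed (cnbhd (f @` `[u, v]) eps).
Proof.
move=> cf; have [vu|uv] := ltP v u.
  rewrite (_ : cnbhd _ _ = set0); first exact: closed0.
  apply/seteqP; split=> // z [w [t /=]]; rewrite in_itv /= => t1; lra.
rewrite -openC openE => z /= nz.
have cd : continuous (fun t => `|z - f t|).
  move=> t; apply: cvg_norm; apply: cvgB; [exact: cvg_cst|exact: cf].
have [|c] := @EVT_min R (fun t => `|z - f t|) u v uv.
  exact: continuous_subspaceT.
move=> c1 cmin; rewrite in_itv in c1.
have ec : eps < `|z - f c|.
  rewrite ltNge; apply/negP => le; apply: nz; exists (f c); last exact: le.
  by exists c => //=; rewrite in_itv.
apply/nbhs_normP; exists (`|z - f c| - eps) => /=; first by rewrite subr_gt0.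
move=> w /= zw [_ [t /= t1 <-] wt].
have := cmin t t1; have := ler_distD w z (f t); lra.
Qed.

Lemma seg_image a b : seg a b = (fun t : R => a + t *: (b - a)) @` `[0, 1].
Proof.
apply/seteqP; split=> z [t /=]; first by move=> t1 ->; exists t => //=; rewrite in_itv.
by rewrite in_itv => t1 <-; exists t.
Qed.

Lemma cnbhd_seg_closed a b eps : closed (cnbhd (seg a b) eps).
Proof. by rewrite seg_image; apply: cnbhd_closed; exact: continuous_line. Qed.

(* The bump [max 0 (1 - 2 |z - x| / r)] is [2/r]-Lipschitz, so adding a multiple
   of norm at most [r/4] of it to the identity keeps the map injective. *)
Lemma push_ball m x y r : 0 < r -> `|x - m| < r / 8 -> `|y - m| < r / 8 ->
  exists h : V -> V, [/\ continuous h, injective h,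
    forall z, r <= `|z - m| -> h z = z,
    forall z, `|z - m| < r -> `|h z - m| < r & h x = y].
Proof.
move=> r0 xm ym.
pose k z := Num.max 0 (1 - 2 * `|z - x| / r).
have k01 z : 0 <= k z <= 1.
  rewrite /k le_max lexx /= ge_max ler01 /= gerBl.
  by rewrite divr_ge0 ?mulr_ge0// ltW.
have k0 z : r / 2 <= `|z - x| -> k z = 0.
  move=> zx; rewrite /k max_l// subr_le0 ler_pdivlMr//; lra.
have kE z : k z = 0 \/ k z = 1 - 2 * `|z - x| / r.
  by rewrite /k; case: leP; [right|left].
have klip z w : `|k z - k w| <= 2 / r * `|z - w|.
  have H u v : k u - k v <= 2 / r * `|u - v|.
    have ge0 : 0 <= 2 / r * `|u - v| by rewrite mulr_ge0// divr_ge0// ltW.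
    have kv : 1 - 2 * `|v - x| / r <= k v by rewrite /k le_max lexx orbT.
    have [ku|ku] := kE u; first by have := k01 v; lra.
    have : 2 / r * `|v - x| <= 2 / r * (`|u - x| + `|u - v|).
      rewrite ler_wpM2l ?divr_ge0 ?(ltW r0)//.
      by have := ler_distD u v x; rewrite (distrC v u); lra.
    by rewrite ku; move: kv; rewrite mulrDr ![2 * _ / r]mulrAC; lra.
  by rewrite ler_norml H andbT -lerNl opprB distrC H.
have xy : `|y - x| < r / 4.
  have := ler_distD m y x; rewrite (distrC m x); lra.
have kxy z w : `|k z - k w| * `|y - x| <= `|z - w| / 2.
  apply: (@le_trans _ _ ((2 / r * `|z - w|) * (r / 4))).
    by apply: ler_pM => //; exact: ltW.
  by rewrite le_eqVlt; apply/orP; left; apply/eqP; field; rewrite gt_eqF.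
pose h z := z + k z *: (y - x).
have hD z w : h z - h w = (z - w) + (k z - k w) *: (y - x).
  by rewrite /h opprD addrACA scalerBl.
exists h; split.
- apply/continuousP_eps => z e e0; exists (e / 2); first lra.
  move=> w zw; rewrite hD (le_lt_trans (ler_normD _ _))// normrZ.
  have := kxy z w; lra.
- move=> z w /eqP; rewrite -subr_eq0 hD addr_eq0 => /eqP zw.
  have : `|z - w| <= `|z - w| / 2.
    by rewrite {1}zw normrN normrZ.
  have := normr_ge0 (z - w) => H1 H2.
  have : `|z - w| == 0 by rewrite eq_le; lra.
  by rewrite normr_eq0 subr_eq0 => /eqP.
- move=> z zm; rewrite /h k0 ?scale0r ?addr0//.
  have := ler_distD x z m; lra.
- move=> z zm; rewrite /h; have [zx|zx] := leP (r / 2) `|z - x|.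
    by rewrite k0// scale0r addr0.
  rewrite addrAC (le_lt_trans (ler_normD _ _))// normrZ ger0_norm; last first.
    by case/andP : (k01 z).
  have := ler_distD x z m; have : k z * `|y - x| <= 1 * `|y - x|.
    by rewrite ler_wpM2r//; case/andP: (k01 z).
  lra.
- by rewrite /h /k subrr normr0 mulr0 mul0r subr0 max_r// scale1r addrC subrK.
Qed.

(** Being able to carry [f u] to [f t] is a locally constant property of [t]: composing with a push
    inside a ball around [f t] moves the image to any nearby point, and such a ball lies in the
    tube. *)
Lemma push_path f u v eps : continuous f -> u <= v -> 0 < eps ->
  let U := onbhd (f @` `[u, v]) eps in
  exists h : V -> V, [/\ continuous h, injective h,
    forall z, ~ U z -> h z = z, forall z, U z -> U (h z) & h (f u) = f v].
Proof.
move=> cf uv e0 U.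
pose c (t : R) := Num.max u (Num.min t v).
have c01 t : u <= c t <= v.
  by rewrite /c le_max lexx /= ge_max uv ge_min lexx orbT.
have cE t : u <= t <= v -> c t = t.
  by move=> /andP[t0 t1]; rewrite /c min_l// max_r.
have cc : continuous c.
  move=> t; apply: (@continuous_max R R (fun=> u) (fun s => Num.min s v) t).
    exact: cvg_cst.
  by apply: continuous_min; [exact: cvg_id|exact: cvg_cst].
have cfc : continuous (f \o c).
  by move=> t; apply: continuous_comp; [exact: cc|exact: cf].
pose S t := exists h : V -> V, [/\ continuous h, injective h,
    forall z, ~ U z -> h z = z, forall z, U z -> U (h z) & h (f u) = f (c t)].
suff /(_ v) : forall t, S t by rewrite /S cE// lexx uv.
apply: (@locally_constant_line _ _ u).
  exists id; split => //; first by move=> ?; exact: cvg_id.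
  by rewrite cE// lexx uv.
have step t w w' : `|w - f (c t)| < eps / 8 -> `|w' - f (c t)| < eps / 8 ->
    (exists h : V -> V, [/\ continuous h, injective h,
    forall z, ~ U z -> h z = z, forall z, U z -> U (h z) & h (f u) = w]) ->
    exists h : V -> V, [/\ continuous h, injective h,
    forall z, ~ U z -> h z = z, forall z, U z -> U (h z) & h (f u) = w'].
  move=> wt wt' [h [ch hi hN hU hw]].
  have [k [ck ki kN kU kw]] := push_ball e0 wt wt'.
  have ball_U z : `|z - f (c t)| < eps -> U z.
    by move=> zt; exists (f (c t)) => //; exists (c t) => //=; rewrite in_itv/= c01.
  exists (k \o h); split.
  - by move=> z; apply: continuous_comp; [exact: ch|exact: ck].
  - exact: inj_comp.
  - move=> z Uz /=; rewrite hN// kN// leNgt; apply/negP => /ball_U; exact: Uz.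
  - move=> z /hU Uhz /=; have [/kU/ball_U//|le] := ltP `|h z - f (c t)| eps.
    by rewrite kN.
  - by rewrite /= hw.
move=> t; have e80 : 0 < eps / 8 by lra.
have /continuousP_eps/(_ t _ e80)[d d0 dP] := cfc.
exists d => // t' /dP /= tt'.
have tt : `|f (c t) - f (c t)| < eps / 8 by rewrite subrr normr0.
by split; apply: (step t) => //; rewrite distrC.
Qed.

End tubes.

(** * Redrawing an edge inside a tube *)

Section strip.
Variables (R : realType) (V : normedModType R) (x y : V) (f : R -> V) (u v eps : R).
Let U : set V := onbhd (f @` `[u, v]) eps.
Let Tx : set V := cnbhd (seg x (f u)) eps.
Let Ty : set V := cnbhd (seg y (f v)) eps.

(** The region to which the redrawn edge is confined. Its cones stand only on points of [U]: if two
    cones of different edges at one vertex met off that vertex, the end of one generating segment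
    would lie in the end tube of the other edge. *)
Definition strip_body : set V := [set z |
  [\/ U z, exists2 p, U p /\ Tx p & seg x p z | exists2 p, U p /\ Ty p & seg y p z]].

Hypotheses (cf : continuous f) (uv : u <= v) (e0 : 0 < eps).
Hypothesis TT : forall z, Tx z -> ~ Ty z.
Hypothesis nUx : ~ U x.

Let Tx_x : Tx x.
Proof. by exists x; [exact: seg_l|rewrite subrr normr0 ltW]. Qed.

Let Uball p t : u <= t <= v -> `|p - f t| < eps -> U p.
Proof. by move=> t1 pt; exists (f t) => //; exists t; rewrite //= in_itv. Qed.

Let far p q := forall z, seg x p z -> seg x q z -> z = x.

(* [h] carries the initial segment [x, f u] through the strip to the other end;
   nearby initial segments are carried along, without ever meeting its image. *)
Lemma strip_arcs : exists A : set V,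
  [/\ arcin A x y, A `<=` strip_body,
      forall z, A z -> [\/ seg x (f u) z, U z | Ty z] &
      exists2 d, 0 < d & forall p, `|p - f u| < d -> far (f u) p ->
        forall z, z <> x -> seg x p z -> (forall w, seg x z w -> ~ U w) ->
        arcin [set w | w = y \/ strip_body w /\ ~ A w] z y].
Proof.
have [h [ch hi hN hU huv]] := push_path cf uv e0.
pose g p (l : R) := h (x + l *: (p - x)).
have cg p : continuous (g p).
  by move=> l; apply: continuous_comp; [exact: continuous_line|exact: ch].
have clTy : closed Ty by exact: cnbhd_seg_closed.
have g0 p : g p 0 = x by rewrite /g scale0r addr0 hN.
have g1 p : g p 1 = h p by rewrite /g scale1r addrC subrK.
pose good p := [/\ U p, Tx p & Ty (h p)].
(* [lam p] will be the first time at which the carried segment enters the tube at [y], and [c p] the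
   entry point. *)
have hitP p : exists l, good p -> [/\ 0 <= l <= 1, Ty (g p l) &
    forall m, 0 <= m -> m < l -> ~ Ty (g p m)].
  have [gp|ngp] := pselect (good p); last by exists 0.
  have [|l lP] := @first_hit _ _ (g p) Ty 1 (cg p) clTy ler01.
    by rewrite g1; case: gp.
  by exists l.
have [lam lamP] := choice hitP; clear hitP.
pose c p := g p (lam p).
have gx p : good p -> p <> x by move=> [Up _ _] px; apply: nUx; rewrite -px.
have gTx p l : good p -> 0 <= l <= 1 -> Tx (x + l *: (p - x)).
  by move=> [_ Txp _] l1; apply: (cnbhd_seg_star Txp); exists l.
have gNU p l : good p -> 0 <= l <= 1 -> ~ U (x + l *: (p - x)) ->
    g p l = x + l *: (p - x) by move=> gp l1 nU; rewrite /g hN.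
have lam0 p : good p -> 0 < lam p.
  move=> gp; have [l1 Tl _] := lamP p gp.
  rewrite lt_neqAle (proj1 (andP l1)) andbT; apply/eqP => l0.
  by move: Tl; rewrite -l0 g0; exact: TT.
(* A point outside [U] is fixed by [h], so an entry point coming from there would lie in both end
   tubes. *)
have Uc p : good p -> U (c p).
  move=> gp; have [l1 Tl _] := lamP p gp.
  have [Uw|nUw] := pselect (U (x + lam p *: (p - x))); first exact: hU.
  by case: (TT (gTx p _ gp l1)); rewrite -gNU.
have gg p q l m : good p -> far p q ->
    0 <= l <= 1 -> 0 <= m <= 1 -> g p l = g q m -> l = 0.
  move=> gp fpq l1 m1 /hi E.
  have /eqP := fpq (x + l *: (p - x)) ltac:(by exists l) ltac:(by rewrite E; exists m).
  rewrite -subr_eq0 addrC addrA addNr add0r scaler_eq0 => /orP[/eqP//|].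
  by rewrite subr_eq0 => /eqP/gx; case.
(* Before its first hit of the tube [Ty], a carried segment cannot cross
   another final segment: its interior points are interior to the tube. *)
have gs p q l : good p -> good q -> far p q ->
    0 <= l <= lam p -> seg y (c q) (g p l) -> False.
  move=> gp gq fpq l1 S; have [lp1 Tl hit] := lamP p gp.
  have [lq1 Tlq _] := lamP q gq.
  have Tgl : Ty (g p l) by apply: (cnbhd_seg_star Tlq).
  have {}l1 : l = lam p.
    have [ll|] := ltP l (lam p); last by lra.
    by case: (hit l) => //; case/andP: l1.
  subst l; have lp0 := lam0 p gp.
  case: S => t t1 E; have [tE|tne] := eqVneq t 1.
    move: E; rewrite tE scale1r addrC subrK => /(gg _ _ _ _ gp fpq lp1 lq1).
    lra.
  have [|r r0 rP] := cnbhd_seg_interior e0 Tlq (t := t).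
    by case/andP: t1 => -> /=; rewrite lt_neqAle tne.
  have /continuousP_eps/(_ (lam p) r r0)[d d0 dP] := cg p.
  pose m := Num.max 0 (lam p - d / 2).
  have m0 : 0 <= m by rewrite le_max lexx.
  have ml : m < lam p by rewrite /m gt_max lp0 /=; lra.
  have md : `|lam p - m| < d.
    rewrite ger0_norm; last lra.
    have : lam p - d / 2 <= m by rewrite /m le_max lexx orbT.
    lra.
  by apply: (hit m m0 ml); apply: rP; rewrite -E; exact: dP.
(* Follow the carried segment from time [l0] up to the entry point, then go straight to [y]. *)
pose tail p l0 : set V :=
  [set w | (exists2 l, l0 <= l <= lam p & w = g p l) \/ seg y (c p) w].
have tail_body p l0 : good p -> 0 <= l0 -> tail p l0 `<=` strip_body.
  move=> gp l00 w; have [lp1 Tl _] := lamP p gp.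
  case=> [[l l1 ->]|S]; last first.
    by apply: Or33; exists (c p) => //; split => //; exact: Uc.
  have l01 : 0 <= l <= 1 by lra.
  have [Uw|nUw] := pselect (U (x + l *: (p - x))); first by apply: Or31; exact: hU.
  rewrite gNU//; apply: Or32; exists p; last by exists l.
  by case: gp.
have tail_arc p l0 : good p -> 0 <= l0 -> l0 <= lam p -> arcin (tail p l0) (g p l0) y.
  move=> gp l00 l0p; have [lp1 _ _] := lamP p gp.
  apply: (@arcin_trans _ _ _ _ (c p)).
    apply: (@arcin_path _ _ _ (g p) l0 (lam p)) => //.
      move=> l m l1 m1 /hi/addrI/eqP.
      rewrite -subr_eq0 -scalerBl scaler_eq0 !subr_eq0 => /orP[/eqP//|].
      by move=> /eqP/gx; case.
    by move=> l l1; left; exists l.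
  by apply: arcin_seg_set => w /seg_sym; right.
pose a := f u.
have huv' : h a = f v := huv.
have gooda : good a.
  split; first by apply: (@Uball _ u); [rewrite lexx uv|rewrite subrr normr0].
    by exists a; [exact: seg_r|rewrite subrr normr0 ltW].
  by rewrite huv'; exists (f v); [exact: seg_r|rewrite subrr normr0 ltW].
have [d d0 dgood] : exists2 d, 0 < d & forall p, `|p - a| < d -> good p.
  have /continuousP_eps/(_ a _ e0)[d d0 dP] := ch.
  exists (Num.min d eps); first by rewrite lt_min d0.
  move=> p; rewrite lt_min => /andP[pd pe]; split.
  - by apply: (@Uball _ u); rewrite // lexx uv.
  - by exists a; [exact: seg_r|exact: ltW].
  - exists (f v); first exact: seg_r.
    by rewrite -huv' distrC ltW// dP// distrC.
have la1 := lamP a gooda.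
exists (tail a 0); split.
- by rewrite -[X in arcin _ X _](g0 a); apply: tail_arc => //; rewrite ltW// lam0.
- exact: tail_body.
- have [lp1 Tl _] := la1.
  move=> w [[l l1 ->]|S]; last by apply: Or33; exact: (cnbhd_seg_star Tl).
  have l01 : 0 <= l <= 1 by lra.
  have [Uw|nUw] := pselect (U (x + l *: (a - x))); first by apply: Or32; exact: hU.
  by rewrite gNU//; apply: Or31; exists l.
- exists d => // p pd fp z zx [m m1 zE] zU.
  have gp := dgood p pd.
  have fp' : far p a by move=> w s1 s2; exact: fp.
  have m0 : 0 < m.
    rewrite lt_neqAle (proj1 (andP m1)) andbT; apply/eqP => m0.
    by apply: zx; rewrite zE -m0 scale0r addr0.
  have seg_z l : 0 <= l <= m -> seg x z (x + l *: (p - x)).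
    move=> l1; exists (l / m).
      by rewrite divr_ge0 ?ler_pdivrMr /=; lra.
    by rewrite zE [x + m *: _]addrC addrK scalerA divfK// gt_eqF.
  have gz : g p m = z by rewrite gNU// -?zE//; apply: zU; exact: seg_r.
  have [lp1 Tl hit] := lamP p gp.
  (* Up to time [m] the segment avoids [U], hence is fixed by [h] and stays in the tube at [x], away
     from [Ty]. *)
  have mp : m <= lam p.
    rewrite leNgt; apply/negP => pm.
    have l1 : 0 <= lam p <= m by lra.
    apply: (TT (gTx p _ gp lp1)); rewrite -gNU//.
    exact/zU/seg_z.
  rewrite -gz; apply: sub_arcin (tail_arc p m gp (ltW m0) mp) => w wt.
  have [wy|wy] := pselect (w = y); [by left|right].
  split; first by apply: tail_body wt => //; exact: ltW.
  have [la11 Tla _] := la1.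
  move=> [[l' l'1 wE']|S'].
    case: wt => [[l l1 wE]|S]; last first.
      by apply: (@gs a p l') => //; rewrite -wE'.
    have := @gg p a l l' gp fp' ltac:(lra) ltac:(lra).
    by rewrite -wE -wE' => /(_ erefl); lra.
  case: wt => [[l l1 wE]|S].
    by apply: (@gs p a l) => //; [lra|rewrite -wE].
  have [//|S1|S1] := seg_meet S S'.
    by apply: (gs a p (lam a)) => //; rewrite lexx andbT; case/andP: la11.
  by apply: (gs p a (lam p)) => //; rewrite lexx andbT; case/andP: lp1.
Qed.

End strip.

(** * Straightening a drawing near its vertices *)

Lemma finite_uniform (R : realType) (I : finType) (P : I -> R -> Prop) :
  (forall i, exists2 d, 0 < d & P i d) ->
  (forall i d d', 0 < d' -> d' <= d -> P i d -> P i d') ->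
  exists2 d, 0 < d & forall i, P i d.
Proof.
move=> H mono.
suff [d d0 dP] : exists2 d, 0 < d & forall i, i \in enum I -> P i d.
  by exists d => // i; apply: dP; rewrite mem_enum.
elim: (enum I) => [|i r [d d0 dP]]; first by exists 1.
have [d' d'0 d'P] := H i.
exists (Num.min d d'); first by rewrite lt_min d0.
have m0 : 0 < Num.min d d' by rewrite lt_min d0.
move=> j; rewrite inE => /orP[/eqP->|/dP].
  by apply: mono d'P => //; rewrite ge_min lexx orbT.
by apply: mono => //; rewrite ge_min lexx.
Qed.

Section straighten.
Variables (R : realType).
Local Notation V := (R * R)%type.

(** The closed ball is the tube around the degenerate segment at [p]. If the first hit were strictly
    inside, slightly earlier points would be inside too. *)
Lemma first_hit_ball (f : R -> V) (p : V) r L : continuous f -> 0 <= L ->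
  r < `|f 0 - p| -> `|f L - p| <= r ->
  exists t0, [/\ 0 <= t0 <= L, `|f t0 - p| = r &
    forall t, 0 <= t -> t < t0 -> r < `|f t - p|].
Proof.
move=> cf L0 f0 fL.
have cK : closed (cnbhd (seg p p) r) by exact: cnbhd_seg_closed.
have KE z : cnbhd (seg p p) r z <-> `|z - p| <= r.
  split=> [[_ [t _ ->]]|zp]; first by rewrite subrr scaler0 addr0.
  by exists p => //; exact: seg_l.
have [|t0 [t01 /KE K0 hit]] := first_hit cf cK L0; first exact/KE.
have {}hit t : 0 <= t -> t < t0 -> r < `|f t - p|.
  by move=> t1 t2; rewrite ltNge; apply/negP => /KE; exact: hit.
exists t0; split => //; apply/eqP; rewrite eq_le K0 /= leNgt; apply/negP => lt.
have e0 : 0 < r - `|f t0 - p| by rewrite subr_gt0.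
have /continuousP_eps/(_ t0 _ e0)[d d0 dP] := cf.
have t00 : 0 < t0.
  rewrite lt_neqAle (proj1 (andP t01)) andbT; apply/eqP => t00.
  by move: f0; rewrite t00; lra.
pose m := Num.max 0 (t0 - d / 2).
have m0 : 0 <= m by rewrite le_max lexx.
have ml : m < t0 by rewrite /m gt_max t00 /=; lra.
have md : `|t0 - m| < d.
  rewrite ger0_norm; last lra.
  have : t0 - d / 2 <= m by rewrite /m le_max lexx orbT.
  lra.
have := dP m md; have := hit m m0 ml; have := ler_distD (f t0) (f m) p.
rewrite (distrC (f m) (f t0)); lra.
Qed.

(** Cut the arc at its last exit from the ball around [p], which is the first hit of the reversed
    arc, and then at the next entry into the ball around [q]. *)
Lemma arc_middle (p q : V) C r : is_arc p q C -> 0 < r -> 2 * r < `|p - q| ->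
  exists (f : R -> V) (u v : R), [/\ continuous f, u <= v,
    forall t, u <= t <= v -> C (f t),
    `|f u - p| = r /\ `|f v - q| = r &
    forall t, u <= t <= v ->
      (`|f t - p| <= r -> f t = f u) /\ (`|f t - q| <= r -> f t = f v)].
Proof.
move=> /is_arc_path[f [cf fi f0 f1 CE]] r0 pq.
have cf1 : continuous (fun t : R => f (1 - t)).
  move=> t; apply: continuous_comp; last exact: cf.
  by apply: cvgB; [exact: cvg_cst|exact: cvg_id].
have [||t0 [t01 ft0 hit]] := @first_hit_ball _ p r 1 cf1 ler01.
- by rewrite subr0 f1 distrC; lra.
- by rewrite subrr f0 subrr normr0 ltW.
pose u := 1 - t0.
have {}hit t : u < t -> t <= 1 -> r < `|f t - p|.
  move=> ut t1; have := hit (1 - t); rewrite subKr.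
  by apply; rewrite /u in ut; lra.
have cf2 : continuous (fun t : R => f (u + t)).
  move=> t; apply: continuous_comp; last exact: cf.
  by apply: cvgD; [exact: cvg_cst|exact: cvg_id].
have u01 : 0 <= u <= 1 by rewrite /u; lra.
have [|||t2 [t21 ft2 hit2]] := @first_hit_ball _ q r (1 - u) cf2.
- by lra.
- by rewrite addr0; have := ler_distD (f u) p q; rewrite (distrC p (f u)) /u ft0; lra.
- rewrite (_ : u + (1 - u) = 1); last by ring.
  by rewrite f1 subrr normr0 ltW.
exists f, u, (u + t2); split => //.
- lra.
- by move=> t t1; rewrite CE; exists t => //=; rewrite in_itv /=; lra.
- move=> t t1; split => le.
  + have [ut|tu] := ltP u t; first by exfalso; have := hit t ut ltac:(lra); lra.
    by congr f; lra.
  + have [tu|ut] := ltP t (u + t2); last by congr f; lra.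
    exfalso; have := hit2 (t - u) ltac:(lra) ltac:(lra).
    by rewrite (_ : u + (t - u) = t); [lra|ring].
Qed.

Section drawing.
Variables (T : finType) (e : rel T) (pos : T -> V) (curve : {set T} -> set V).
Hypotheses (e_simple : simple_graph e) (dr : plane_drawing e pos curve).

(** Each of the finitely many conditions holds for small [r], by injectivity of [pos] or by
    compactness of an arc that avoids the vertex. *)
Lemma separation_radius : exists2 r, 0 < r &
  (forall x y, x != y -> 3 * r < `|pos x - pos y|) /\
  (forall x y z w, e x y -> z != x -> z != y -> curve [set x; y]%SET w ->
     r < `|w - pos z|).
Proof.
case: dr => pos_inj arcs avoid _.
pose P (i : T * T * T) (r : R) :=
  (i.1.1 != i.1.2 -> 3 * r < `|pos i.1.1 - pos i.1.2|) /\
  (forall w, e i.1.1 i.1.2 -> i.2 != i.1.1 -> i.2 != i.1.2 ->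
    curve [set i.1.1; i.1.2]%SET w -> r < `|w - pos i.2|).
have [|i d d' d'0 dd'|r r0 rP] := @finite_uniform R _ P.
- move=> [[x y] z] /=.
  have [r1 r10 r1P] : exists2 r, 0 < r & x != y -> 3 * r < `|pos x - pos y|.
    have [<-|xy] := eqVneq x y; first by exists 1.
    have : 0 < `|pos x - pos y| by rewrite normr_gt0 subr_eq0 (inj_eq pos_inj).
    by exists (`|pos x - pos y| / 4); lra.
  suff [r2 r20 r2P] : exists2 r, 0 < r & (forall w, e x y -> z != x -> z != y ->
    curve [set x; y]%SET w -> r < `|w - pos z|).
    exists (Num.min r1 r2); first by rewrite lt_min r10.
    split=> /= [/r1P|w H1 H2 H3 H4].
      have : Num.min r1 r2 <= r1 by rewrite ge_min lexx.
      lra.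
    by apply: le_lt_trans (r2P _ H1 H2 H3 H4); rewrite ge_min lexx orbT.
  have [exy|] := boolP (e x y); last by exists 1.
  have [->|zx] := eqVneq z x; first by exists 1.
  have [->|zy] := eqVneq z y; first by exists 1.
  have /is_arc_path[f [cf _ _ _ CE]] := arcs _ _ exy.
  have cg : continuous (fun _ : R => pos z) by move=> ?; exact: cvg_cst.
  have [|eps e0 eP] := @path_sep R V f _ 0 1 0 1 cf cg.
    move=> t u t1 _ ftz; have [zE|zE] : z = x \/ z = y.
    - by apply: (avoid x y z exy); rewrite CE -ftz; exists t => //=; rewrite in_itv.
    - by rewrite zE eqxx in zx.
    - by rewrite zE eqxx in zy.
  exists (eps / 2); first lra.
  move=> w _ _ _; rewrite CE => -[t /=]; rewrite in_itv /= => t1 <-.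
  by have := eP t 0 t1 ltac:(lra); lra.
- move=> [H1 H2]; split=> [/H1|w a b c dd]; first lra.
  by apply: le_lt_trans (H2 w a b c dd).
exists r => //; split=> [x y|x y z w].
  exact: (rP (x, y, x)).1.
by move=> H1 H2 H3 H4; exact: ((rP (x, y, z)).2 w H1 H2 H3 H4).
Qed.

Variable o : T -> nat.
Hypothesis o_inj : injective o.

(** Each edge is represented once, starting from the end with the smaller label. The labelling stays
    a parameter so that a chosen vertex can be made the first end of all its edges. *)
Definition oriented (i : T * T) := e i.1 i.2 && (o i.1 < o i.2)%N.
Definition ends (i : T * T) : {set T} := [set i.1; i.2]%SET.

Lemma ends_inj i j : oriented i -> oriented j -> ends i = ends j -> i = j.
Proof.
case: i j => [x y] [x' y'] /andP[/= _ xy] /andP[/= _ xy'] E.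
have : x \in ends (x', y') by rewrite -E !inE eqxx.
have : y \in ends (x', y') by rewrite -E !inE eqxx orbT.
by rewrite !inE /= => /orP[]/eqP yE /orP[]/eqP xE; move: xy xy';
  rewrite yE xE ?ltnn // => lt1 /(ltn_trans lt1); rewrite ltnn.
Qed.

Lemma orientedP x y : e x y -> exists2 i, oriented i &
  ends i = [set x; y]%SET /\ (i = (x, y) \/ i = (y, x)).
Proof.
move=> exy; case: e_simple => sym irr.
have := ltn_neqAle (o x) (o y); case: ltngtP => // [xy _|yx _|].
- by exists (x, y); [rewrite /oriented exy|split => //; left].
- exists (y, x); first by rewrite /oriented sym exy.
  by split; [rewrite /ends finset.setUC|right].
- by move=> /o_inj xy; rewrite xy irr in exy.
Qed.

Definition edge_end (F : T * T -> R -> V) (u v : T * T -> R) i z :=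
  if z == i.1 then F i (u i) else F i (v i).

(** The middle part of an edge stays at distance at least [r] from all vertices, so it could meet an
    end segment of another edge only at the outer end of that segment. This end lies on the other
    curve, and curves meet only at vertices. Compactness then gives uniform gaps. *)
Lemma straightening : exists (F : T * T -> R -> V) (u v : T * T -> R) (r eps : R),
  let U i := onbhd (F i @` `[u i, v i]) eps in
  let W i z := cnbhd (seg (pos z) (edge_end F u v i z)) eps in
  [/\ 0 < r /\ 0 < eps <= r / 4,
      forall x y, x != y -> 3 * r < `|pos x - pos y|,
      forall i, oriented i -> [/\ continuous (F i), u i <= v i &
        forall z, z \in ends i -> `|edge_end F u v i z - pos z| = r],
      forall i z w, oriented i -> U i w -> 3 / 4 * r <= `|w - pos z| &
      forall i j w, oriented i -> oriented j -> i != j -> U i w ->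
        ~ U j w /\ forall z, z \in ends j -> ~ W j z w].
Proof.
case: (dr) => pos_inj arcs avoid meet.
have [r r0 [rpos rcurve]] := separation_radius.
pose D := ((R -> V) * R * R)%type.
pose Q (i : T * T) (d : D) := let: (f, u, v) := d in
  [/\ continuous f, u <= v, forall t, u <= t <= v -> curve (ends i) (f t),
    `|f u - pos i.1| = r /\ `|f v - pos i.2| = r &
    forall t, u <= t <= v -> (`|f t - pos i.1| <= r -> f t = f u) /\
      (`|f t - pos i.2| <= r -> f t = f v)].
have ne i : oriented i -> i.1 != i.2.
  by move=> /andP[_ lt]; apply/eqP => E; rewrite E ltnn in lt.
have dataP i : exists d : D, oriented i -> Q i d.
  have [io|] := boolP (oriented i); last by exists (fun=> 0, 0, 0).
  have [||f [u [v H]]] := @arc_middle _ _ (curve (ends i)) r (arcs i.1 i.2 _) r0.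
  - by case/andP: io.
  - by have := rpos _ _ (ne _ io); lra.
  - by exists (f, u, v).
have [dat datP] := choice dataP; clear dataP.
pose F i := (dat i).1.1; pose u i := (dat i).1.2; pose v i := (dat i).2.
have FP i : oriented i -> Q i (F i, u i, v i).
  by move=> /datP; rewrite /F /u /v; case: (dat i) => [[]].
pose ee := edge_end F u v.
have far i t z : oriented i -> u i <= t <= v i -> r <= `|F i t - pos z|.
  move=> io t1; have [cF uv FC [H1 H2] H] := FP i io.
  have [->|zx] := eqVneq z i.1.
    by have [le|/ltW//] := leP `|F i t - pos i.1| r; rewrite (H t t1).1// H1.
  have [->|zy] := eqVneq z i.2.
    by have [le|/ltW//] := leP `|F i t - pos i.2| r; rewrite (H t t1).2// H2.
  by apply/ltW/(rcurve i.1 i.2) => //; [case/andP : io|exact: FC].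
have ee_dist i z : oriented i -> z \in ends i -> `|ee i z - pos z| = r.
  move=> io; have [_ _ _ [H1 H2] _] := FP i io.
  rewrite !inE /ee /edge_end => /orP[]/eqP->; first by rewrite eqxx.
  by rewrite eq_sym (negbTE (ne _ io)).
have ee_mid i z : oriented i -> exists2 t, u i <= t <= v i & ee i z = F i t.
  move=> io; have [_ uv _ _ _] := FP i io; rewrite /ee /edge_end.
  by case: ifP => _; [exists (u i)|exists (v i)]; rewrite // lexx uv.
have MM i j t t' : oriented i -> oriented j -> i != j -> u i <= t <= v i ->
    u j <= t' <= v j -> F i t <> F j t'.
  move=> io jo ij t1 t1' E.
  have [_ _ FC _ _] := FP i io; have [_ _ FC' _ _] := FP j jo.
  have nE : ends i <> ends j.
    by move=> /(ends_inj io jo) E'; rewrite E' eqxx in ij.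
  have [|z _ zE] := meet _ _ _ _ (proj1 (andP io)) (proj1 (andP jo)) nE (F i t).
    by split; [exact: FC|rewrite E; exact: FC'].
  by have := far i t z io t1; rewrite -zE subrr normr0; lra.
have MS i j t z : oriented i -> oriented j -> i != j -> u i <= t <= v i ->
    z \in ends j -> ~ seg (pos z) (ee j z) (F i t).
  move=> io jo ij t1 zj [l l1 E].
  have [cF uv FC [H1 H2] H] := FP i io.
  have [t' t'1 eeE] := ee_mid j z jo.
  have dE : `|F i t - pos z| = l * r.
    rewrite E addrC addKr normrZ ger0_norm ?ee_dist//.
    by case/andP: l1.
  have lE : l = 1.
    have := far i t z io t1; rewrite dE => rl.
    by apply/eqP; rewrite eq_le (proj2 (andP l1)) /= -(ler_pM2r r0) mul1r.
  apply: (MM i j t t' io jo ij t1 t'1).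
  by rewrite -eeE E lE scale1r addrC subrK.
pose P (ij : (T * T) * (T * T)) (d : R) :=
  oriented ij.1 -> oriented ij.2 -> ij.1 != ij.2 ->
  forall t, u ij.1 <= t <= v ij.1 ->
    (forall t', u ij.2 <= t' <= v ij.2 -> d <= `|F ij.1 t - F ij.2 t'|) /\
    forall z w, z \in ends ij.2 -> seg (pos z) (ee ij.2 z) w -> d <= `|F ij.1 t - w|.
have [[i j]|ij d d' d'0 dd' H io jo ijn t t1|d d0 dP] := @finite_uniform R _ P.
- rewrite /P /=.
  have [io|] := boolP (oriented i); last by exists 1.
  have [jo|] := boolP (oriented j); last by exists 1.
  have [<-|ij] := eqVneq i j; first by exists 1.
  have [cF _ _ _ _] := FP i io; have [cF' _ _ _ _] := FP j jo.
  have [d1 d10 d1P] := path_sep cF cF'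
    (fun t t' t1 t1' => @MM i j t t' io jo ij t1 t1').
  have segsep z : z \in ends j -> exists2 d, 0 < d & forall t w,
      u i <= t <= v i -> seg (pos z) (ee j z) w -> d <= `|F i t - w|.
    move=> zj; have [|d d0 dP] := path_sep cF
        (@continuous_line R V (pos z) (ee j z - pos z)) (a := u i) (b := v i)
        (c := 0) (d := 1).
      by move=> t l t1 l1 E; apply: (MS i j t z) => //; exists l.
    by exists d => // t w t1 [l l1 ->]; exact: dP.
  have [d2 d20 d2P] := segsep j.1 ltac:(by rewrite !inE eqxx).
  have [d3 d30 d3P] := segsep j.2 ltac:(by rewrite !inE eqxx orbT).
  exists (Num.min d1 (Num.min d2 d3)); first by rewrite !lt_min d10 d20.
  move=> _ _ _ t t1; split=> [t' t1'|z w].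
    by apply: le_trans (d1P t t' t1 t1'); rewrite ge_min lexx.
  rewrite !inE => /orP[]/eqP-> sw.
    by apply: le_trans (d2P t w t1 sw); rewrite !ge_min lexx orbT.
  by apply: le_trans (d3P t w t1 sw); rewrite !ge_min lexx !orbT.
- have [H1 H2] := H io jo ijn t t1; split=> [t' t1'|z w zj sw].
    exact: le_trans dd' (H1 t' t1').
  exact: le_trans dd' (H2 z w zj sw).
(* The bound [d / 2] keeps tubes around sets at distance [d] disjoint; [r / 4] keeps middle tubes at
   distance [3 / 4 * r] from the vertices. *)
exists F, u, v, r, (Num.min (d / 2) (r / 4)) => U W.
have ler4 : Num.min (d / 2) (r / 4) <= r / 4 by rewrite ge_min lexx orbT.
have led2 : Num.min (d / 2) (r / 4) <= d / 2 by rewrite ge_min lexx.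
split=> //.
- by split=> //; rewrite ler4 andbT lt_min; apply/andP; split; lra.
- by move=> i io; have [cF uv _ _ _] := FP i io; split=> // z; exact: ee_dist.
- move=> i z w io [_ [t /= t1 <-] wt]; rewrite in_itv /= in t1.
  have := far i t z io t1; have := ler_distD w (F i t) (pos z).
  rewrite (distrC (F i t) w); lra.
- move=> i j w io jo ij [_ [t /= t1 <-] wt]; rewrite in_itv /= in t1.
  have [H1 H2] := dP (i, j) io jo ij t t1.
  split=> [[_ [t' /= t1' <-] wt']|z zj [w' sw ww']].
    rewrite in_itv /= in t1'.
    have := H1 t' t1'; have := ler_distD w (F i t) (F j t').
    rewrite (distrC (F i t) w); lra.
  have := H2 z w' zj sw; have := ler_distD w (F i t) w'.
  rewrite (distrC (F i t) w); lra.
Qed.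

End drawing.
End straighten.

(** * Redrawing the edges around one vertex *)

Lemma arcin_l (R : realType) (V : normedModType R) (Z : set V) a b :
  arcin Z a b -> Z a.
Proof. by move=> [L [f [L0 [_ _ <- _]]]]; apply; rewrite lexx. Qed.

Lemma is_arc_sym (R : realType) (a b : R * R) A : is_arc a b A -> is_arc b a A.
Proof.
move=> /is_arc_path[f [cf fi f0 f1 AE]].
exists (fun t : R => f (1 - t)); split.
- apply: continuous_subspaceT => t; apply: continuous_comp; last exact: cf.
  by apply: cvgB; [exact: cvg_cst|exact: cvg_id].
- move=> t u; rewrite !in_itv /= => t1 u1 /fi H.
  by have := H ltac:(lra) ltac:(lra); lra.
- by rewrite subr0.
- by rewrite subrr.
- rewrite AE; apply/seteqP; split => w [t /=]; rewrite in_itv /= => t1 <-.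
    by exists (1 - t); rewrite /= ?subKr ?in_itv//=; lra.
  by exists (1 - t); rewrite //= in_itv /=; lra.
Qed.

Definition off_curves (R : realType) (T : finType) (e : rel T)
    (curve : {set T} -> set (R * R)) : set (R * R) :=
  [set w | forall x y, e x y -> ~ curve [set x; y]%SET w].

(* A vertex [s] can be drawn so that its edges leave it along segments and every
   point close to such a segment, but off it, sees the other end of the edge. *)
Lemma star_drawing (R : realType) (T : finType) (e : rel T)
    (pos0 : T -> R * R) (curve0 : {set T} -> set (R * R)) (s : T) :
  simple_graph e -> plane_drawing e pos0 curve0 ->
  exists (pos : T -> R * R) curve (a : T -> R * R) (k d : R),
  [/\ plane_drawing e pos curve,
      [/\ 0 < k, 0 < d & forall x, x != s -> k < `|pos x - pos s|],
      forall p, e s p -> [/\ `|a p - pos s| = k, curve [set s; p]%SET (a p) &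
        forall q, e s q -> a p = a q -> p = q],
      forall w, `|w - pos s| = k -> ~ off_curves e curve w ->
        exists2 p, e s p & w = a p &
      forall p w, e s p -> `|w - pos s| = k -> w <> a p -> `|w - a p| < d ->
        arcin [set z | z = pos p \/ off_curves e curve z] w (pos p)].
Proof.
(* The smallest label goes to [s], so that all edges at [s] start there: [strip_arcs] gives
   visibility near the first end only. *)
move=> es dr; pose o x := if x == s then 0%N else (enum_rank x).+1.
have o_inj : injective o.
  move=> x y; rewrite /o; case: eqVneq => [->|xs]; case: eqVneq => [->|ys] //.
  by case=> /val_inj/enum_rank_inj.
have [F [u [v [r [eps H]]]]] := straightening dr o.
pose U i := onbhd (F i @` `[u i, v i]) eps.
pose W i z := cnbhd (seg (pos0 z) (edge_end F u v i z)) eps.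
case: H; rewrite -/U -/W => -[r0 /andP[e0 er]] rpos FP Ufar Udisj.
pose pos := pos0; have pos_inj : injective pos by case: dr.
pose ee := edge_end F u v.
have ne i : oriented e o i -> i.1 != i.2.
  by move=> /andP[_ lt]; apply/eqP => E; rewrite E ltnn in lt.
have W_near i z w : oriented e o i -> z \in ends i -> W i z w -> `|w - pos z| <= 5 / 4 * r.
  move=> io zi [_ [t t1 ->] wt]; have [_ _ eeP] := FP i io.
  have : `|t *: (ee i z - pos z)| <= 1 * r.
    by rewrite normrZ eeP// ler_wpM2r ?(ltW r0)// ger0_norm; lra.
  have := ler_distD (pos z + t *: (ee i z - pos z)) w (pos z).
  have -> : pos z + t *: (ee i z - pos z) - pos z = t *: (ee i z - pos z).
    by rewrite addrC addKr.
  by move: wt; rewrite -/ee -/pos; lra.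
(* End tubes lie within [5 / 4 * r] of their vertices, which are more than [3 * r] apart. *)
have WW i j z z' w : oriented e o i -> oriented e o j -> z \in ends i ->
    z' \in ends j -> z != z' -> W i z w -> ~ W j z' w.
  move=> io jo zi zj zz /(W_near _ _ _ io zi) H1 /(W_near _ _ _ jo zj) H2.
  have := rpos _ _ zz; have := ler_distD w (pos z) (pos z').
  rewrite (distrC (pos z) w); rewrite /pos in H1 H2 *; lra.
pose body i := strip_body (pos i.1) (pos i.2) (F i) (u i) (v i) eps.
have e1 i : ee i i.1 = F i (u i) by rewrite /ee /edge_end eqxx.
have e2 i : oriented e o i -> ee i i.2 = F i (v i).
  by move=> io; rewrite /ee /edge_end eq_sym (negbTE (ne _ io)).
have bodyP i w : oriented e o i -> body i w ->
    U i w \/ exists z p, [/\ z \in ends i, U i p, W i z p & seg (pos z) p w].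
  move=> io; case; [by left| |] => -[p [Up Tp] S]; right.
    exists i.1, p; split => //; first by rewrite !inE eqxx.
    by rewrite /W -/ee e1.
  exists i.2, p; split => //; first by rewrite !inE eqxx orbT.
  by rewrite /W -/ee e2.
(* Middle tubes avoid the tubes of other edges, and cones at distinct vertices lie in disjoint
   tubes. This leaves two cones at a common vertex, to which [seg_meet] applies. *)
have body_meet i j w : oriented e o i -> oriented e o j -> i != j ->
    body i w -> body j w -> exists z, [/\ z \in ends i, z \in ends j & w = pos z].
  move=> io jo ij /(bodyP _ _ io) bi /(bodyP _ _ jo) bj.
  have ji : j != i by rewrite eq_sym.
  case: bi => [Ui|[z [p [zi Up Wp S]]]]; case: bj => [Uj|[z' [p' [zj Up' Wp' S']]]].
  - by case: (Udisj i j w io jo ij Ui).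
  - by case: (Udisj i j w io jo ij Ui) => _ /(_ z' zj) []; exact: (cnbhd_seg_star Wp').
  - by case: (Udisj j i w jo io ji Uj) => _ /(_ z zi) []; exact: (cnbhd_seg_star Wp).
  - have Wi : W i z w by exact: (cnbhd_seg_star Wp).
    have Wj : W j z' w by exact: (cnbhd_seg_star Wp').
    have [zz|zz] := eqVneq z z'; last by case: (WW i j z z' w).
    subst z'; exists z; split => //.
    have [//|S1|S1] := seg_meet S S'.
    + have : W i z p' by exact: (cnbhd_seg_star Wp).
      by case: (Udisj j i p' jo io ji Up') => _ /(_ z zi).
    + have : W j z p by exact: (cnbhd_seg_star Wp').
      by case: (Udisj i j p io jo ij Up) => _ /(_ z zj).
have nU i z : oriented e o i -> ~ U i (pos z).
  by move=> io /(Ufar _ z _ io); rewrite subrr normr0; lra.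
have body_pos i z : oriented e o i -> body i (pos z) -> z \in ends i.
  move=> io /(bodyP _ _ io) [/(nU _ _ io)//|[z' [p [zi Up Wp S]]]].
  have [->//|zz] := eqVneq z z'.
  have : W i z' (pos z) by exact: (cnbhd_seg_star Wp).
  by move/(W_near _ _ _ io zi); have := rpos _ _ zz; rewrite /pos; lra.
have stripP i : exists B : set (R * R), oriented e o i ->
  [/\ arcin B (pos i.1) (pos i.2), B `<=` body i,
      forall z, B z -> [\/ seg (pos i.1) (F i (u i)) z, U i z | W i i.2 z] &
      exists2 d, 0 < d & forall p, `|p - F i (u i)| < d ->
        (forall z, seg (pos i.1) (F i (u i)) z -> seg (pos i.1) p z -> z = pos i.1) ->
        forall z, z <> pos i.1 -> seg (pos i.1) p z ->
        (forall w, seg (pos i.1) z w -> ~ U i w) ->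
        arcin [set w | w = pos i.2 \/ body i w /\ ~ B w] z (pos i.2)].
  have [io|] := boolP (oriented e o i); last by exists set0.
  have [cF uv _] := FP i io.
  have [||B BP] := @strip_arcs R _ (pos i.1) (pos i.2) (F i) (u i) (v i) eps cF uv e0.
  - rewrite -e1 -e2// => z; apply: (WW i i i.1 i.2) => //.
    + by rewrite !inE eqxx.
    + by rewrite !inE eqxx orbT.
    + exact: ne.
  - exact: nU.
  - by exists B => _; rewrite /W -/ee e2.
have [B BP] := choice stripP; clear stripP.
have arcP i : exists A : set (R * R), oriented e o i ->
    is_arc (pos i.1) (pos i.2) A /\ A `<=` B i.
  have [io|] := boolP (oriented e o i); last by exists set0.
  have [arcB _ _ _] := BP i io.
  have [|A A1 A2] := arcin_is_arc _ arcB; last by exists A.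
  by move/pos_inj/eqP; rewrite (negbTE (ne _ io)).
have [A AP] := choice arcP; clear arcP.
have [d d0 dP] : exists2 d, 0 < d & forall i, oriented e o i ->
  forall p, `|p - F i (u i)| < d ->
        (forall z, seg (pos i.1) (F i (u i)) z -> seg (pos i.1) p z -> z = pos i.1) ->
        forall z, z <> pos i.1 -> seg (pos i.1) p z ->
        (forall w, seg (pos i.1) z w -> ~ U i w) ->
        arcin [set w | w = pos i.2 \/ body i w /\ ~ B i w] z (pos i.2).
  apply: finite_uniform => [i|i d d' d'0 dd' H io p pd].
    have [io|] := boolP (oriented e o i); last by exists 1.
    by have [_ _ _ [d d0 dP]] := BP i io; exists d.
  by apply: H => //; exact: lt_le_trans pd dd'.
pose curve (E : {set T}) : set (R * R) :=
  [set w | exists2 i, oriented e o i /\ E = ends i & A i w].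
have curveE i : oriented e o i -> curve (ends i) = A i.
  move=> io; apply/seteqP; split=> w; last by exists i.
  by case=> j [jo E] Aj; rewrite (ends_inj io jo E).
have A_body i : oriented e o i -> A i `<=` body i.
  by move=> io w Aw; have [_ Bb _ _] := BP i io; apply: Bb; apply: (AP i io).2.
have drN : plane_drawing e pos curve.
  split=> //.
  - move=> x y exy; have [i io [<- ixy]] := orientedP es o_inj exy.
    rewrite curveE//; have [arcA _] := AP i io.
    case: ixy arcA => -> //=; exact: is_arc_sym.
  - move=> x y z exy; have [i io [<- ixy]] := orientedP es o_inj exy.
    rewrite curveE// => /(A_body i io)/(body_pos i z io).
    by rewrite !inE; case: ixy => -> /= /orP[]/eqP->; tauto.
  - move=> x y x' y' exy exy'.
    have [i io [<- ixy]] := orientedP es o_inj exy.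
    have [j jo [<- jxy]] := orientedP es o_inj exy'.
    move=> nE w; rewrite !curveE// => -[/(A_body i io) bi /(A_body j jo) bj].
    have ij : i != j by apply/eqP => ij; apply: nE; rewrite ij.
    have [z [zi zj ->]] := body_meet i j w io jo ij bi bj.
    have mem k b c : k = (b, c) \/ k = (c, b) -> z \in ends k -> z = b \/ z = c.
      by case=> ->; rewrite !inE => /orP[]/eqP->; tauto.
    by exists z => //=; split; [exact: mem ixy zi|exact: mem jxy zj].
have so p : e s p -> oriented e o (s, p).
  move=> sp; rewrite /oriented sp /o eqxx /=; case: eqVneq => // ps.
  by case: es => _ irr; rewrite ps irr in sp.
have fF p : e s p -> `|F (s, p) (u (s, p)) - pos s| = r.
  move=> sp; have [_ _ H] := FP _ (so p sp); rewrite -(e1 (s, p)); apply: H.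
  by rewrite !inE eqxx.
(* The midpoint of the initial segment of the edge; the circle of radius [r / 2] around [s] is used
   from here on. *)
pose a p := pos s + 2^-1 *: (F (s, p) (u (s, p)) - pos s).
have half_inj (p q : R * R) :
    pos s + 2^-1 *: (p - pos s) = pos s + 2^-1 *: (q - pos s) -> p = q.
  move/addrI/scalerI => H; have : p - pos s = q - pos s by apply: H; rewrite invr_eq0.
  by move/addIr.
(* Middle tubes are at distance at least [3 / 4 * r] from [s], and tubes at other vertices miss this
   circle, so only an initial segment at [s] reaches it. *)
have circle i w : oriented e o i -> A i w -> `|w - pos s| = r / 2 ->
    e s i.2 /\ w = a i.2.
  move=> io Aw wk; have [_ AB] := AP i io; have [_ _ H _] := BP i io.
  have far z : z \in ends i -> z != s -> ~ W i z w.
    move=> zi zs /(W_near _ _ _ io zi) H1; have := rpos _ _ zs.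
    have := ler_distD w (pos z) (pos s); rewrite (distrC (pos z) w).
    move: H1 wk; rewrite /pos; lra.
  have i2s : i.2 != s.
    apply/eqP => E; move: io; rewrite /oriented E /o eqxx andbC; by case: ifP.
  case: (H w (AB w Aw)) => [S|/(Ufar i s w io)|/far[]//].
  + have i1s : i.1 = s.
      apply/eqP; apply/negPn/negP => i1s; apply: (far i.1) => //.
        by rewrite !inE eqxx.
      apply: cnbhd_seg_star S; exists (ee i i.1); first exact: seg_r.
      by rewrite e1 subrr normr0 ltW.
    have iE : i = (s, i.2) by rewrite -i1s; case: (i).
    have sp : e s i.2 by move: io => /andP[]; rewrite i1s.
    split=> //; rewrite /a -iE.
    case: S; rewrite i1s => t t1 wE; rewrite wE; congr (_ + _ *: _).
    have := wk; rewrite wE addrC addKr normrZ iE fF// ger0_norm; last lra.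
    by move=> E; apply: (mulIf (lt0r_neq0 r0)); rewrite E mulrC.
  + by move=> ge; exfalso; move: wk ge; rewrite /pos; lra.
  + by rewrite !inE eqxx orbT.
have far_s x : x != s -> r / 2 < `|pos x - pos s|.
  by move=> xs; have := rpos _ _ xs; rewrite /pos; lra.
exists pos, curve, a, (r / 2), (d / 2); split => //.
- by split; [lra|lra|].
- move=> p sp; have io := so p sp; split.
  + by rewrite /a addrC addKr normrZ fF// ger0_norm ?invr_ge0// mulrC.
  + have := curveE _ io; rewrite /ends /= => ->.
    have [/is_arc_path[f [cf fi f0 f1 AE]] _] := AP _ io.
    have cg : continuous (fun t : R => f (1 - t)).
      move=> t; apply: continuous_comp; last exact: cf.
      by apply: cvgB; [exact: cvg_cst|exact: cvg_id].
    have [||t0 [t01 ft0 _]] := @first_hit_ball _ _ (pos s) (r / 2) 1 cg ler01.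
    * rewrite subr0 f1; apply: far_s; apply/eqP => /= E.
      by case: es => _ irr; rewrite E irr in sp.
    * by rewrite subrr f0 subrr normr0; lra.
    have Af : A (s, p) (f (1 - t0)).
      by rewrite AE; exists (1 - t0) => //=; rewrite in_itv /=; lra.
    have [_ E] := circle _ _ io Af ft0.
    have E' : a p = f (1 - t0) by rewrite E.
    by rewrite E'.
  + move=> q sq /half_inj E; apply/eqP; apply/negPn/negP => pq.
    have ne' : (s, p) != (s, q) by rewrite xpair_eqE eqxx.
    have mem i : oriented e o i -> U i (F i (u i)).
      move=> io'; have [_ uv _] := FP i io'; exists (F i (u i)).
        by exists (u i) => //=; rewrite in_itv /= lexx.
      by rewrite subrr normr0.
    have [+ _] := Udisj _ _ _ (so p sp) (so q sq) ne' (mem _ (so p sp)).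
    by apply; rewrite E; apply: mem; exact: so.
- move=> w wk nw; apply: contrapT => nA; apply: nw => x y exy.
  have [i io [<- _]] := orientedP es o_inj exy.
  by rewrite curveE// => /(circle i w io)/(_ wk)[sp wE]; apply: nA; exists i.2.
- move=> p w sp wk wa wd.
  have io := so p sp; set i := (s, p) in io.
  (* The point of the sphere of radius [r] on the ray through [w]. Doubling also doubles the
     distance to [a p], hence the choice of [d / 2]. *)
  pose p' := pos s + 2 *: (w - pos s).
  have wE : w = pos s + 2^-1 *: (p' - pos s).
    rewrite /p' [pos s + 2 *: _]addrC addrK scalerA mulVf// scale1r.
    by rewrite [pos s + _]addrC subrK.
  have p'F : p' <> F i (u i) by move=> E; apply: wa; rewrite wE E.
  have p's : `|p' - pos s| = r.
    by rewrite /p' addrC addKr normrZ wk ger0_norm//; lra.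
  have ws : w <> pos s.
    by move=> E; move: wk; rewrite E subrr normr0; lra.
  have := dP i io p' _ _ w ws _ _; rewrite /= => /(_ _ _ _ _)/wrap[].
  + have -> : p' - F i (u i) = 2 *: (w - a p).
      rewrite wE /a opprD addrACA subrr add0r -scalerBr scalerA divff// scale1r.
      by rewrite opprD addrACA subrr addr0.
    by rewrite normrZ ger0_norm//; lra.
  + move=> z [t t1 zE] [t' t'1 zE'].
    have tt : t = t'.
      have H1 : `|z - pos s| = t * r.
        by rewrite zE addrC addKr normrZ fF// ger0_norm; lra.
      have H2 : `|z - pos s| = t' * r.
        by rewrite zE' addrC addKr normrZ p's ger0_norm; lra.
      by apply: (mulIf (lt0r_neq0 r0)); rewrite -H1 -H2.
    have [t0|t0] := eqVneq t 0; first by rewrite zE t0 scale0r addr0.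
    case: p'F; apply: (@addIr _ (- pos s)); apply: (scalerI t0).
    by apply: (@addrI _ (pos s)); rewrite -zE zE' tt.
  + by exists 2^-1; [lra|].
  + move=> z [t t1 zE] /(Ufar i s z io).
    have : `|z - pos s| = t * (r / 2).
      by rewrite zE addrC addKr normrZ wk ger0_norm; lra.
    by rewrite /pos => ->; nra.
  + apply: sub_arcin => z [->|[bz nB]]; [by left|].
    have [->|zp] := pselect (z = pos p); [by left|right].
    move=> x y exy; have [j jo [<- _]] := orientedP es o_inj exy.
    rewrite curveE// => Az; have [ij|ij] := eqVneq i j.
      by apply: nB; rewrite ij; apply: (AP j jo).2.
    have [z' [zi _ zE]] := body_meet i j z io jo ij bz (A_body j jo z Az).
    move: zi; rewrite !inE => /orP[]/eqP E; last by apply: zp; rewrite zE E.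
    have [arcB _ _ _] := BP i io.
    by apply: nB; rewrite zE E; exact: arcin_l arcB.
Qed.

(** * The circle minus a point *)

Section circle.
Variables (R : realType) (c : R * R) (k : R) (w : R * R).
Hypotheses (k0 : 0 < k) (wk : `|w| = k).

(* Stereographic parametrization of the sphere of radius [k] around [c], for the
   max norm, deprived of the point [c + w]. *)
Let g (l : R) : R * R :=
  ((l ^+ 2 - 1) * w.1 - 2 * l * w.2, (l ^+ 2 - 1) * w.2 + 2 * l * w.1).
Definition circle_param (l : R) : R * R := c + (k / `|g l|) *: g l.

Let N := w.1 ^+ 2 + w.2 ^+ 2.

Let N0 : 0 < N.
Proof.
have [w0|w0] := eqVneq w 0; first by move: wk k0; rewrite w0 normr0 => <-; rewrite ltxx.
rewrite lt_neqAle addr_ge0 ?sqr_ge0// andbT eq_sym paddr_eq0 ?sqr_ge0// !sqrf_eq0.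
apply: contra_neqN w0 => /andP[/eqP w1 /eqP w2].
by rewrite [w]surjective_pairing w1 w2.
Qed.

(** In complex notation [g l] is (l + i)^2 w, whose squared modulus is (l^2 + 1)^2 times [N]. *)
Let g_neq0 l : g l != 0.
Proof.
apply/eqP => -[/eqP + /eqP]; rewrite subr_eq0 addr_eq0 => /eqP e1 /eqP e2.
have : (l ^+ 2 + 1) ^+ 2 * N = 0.
  have -> : (l ^+ 2 + 1) ^+ 2 * N = (l ^+ 2 - 1) * w.1 * ((l ^+ 2 - 1) * w.1) +
    (l ^+ 2 - 1) * w.2 * ((l ^+ 2 - 1) * w.2) + 4 * l ^+ 2 * N by rewrite /N; ring.
  have H1 : (l ^+ 2 - 1) * N = 0.
    have -> : (l ^+ 2 - 1) * N = w.1 * ((l ^+ 2 - 1) * w.1) + w.2 * ((l ^+ 2 - 1) * w.2).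
      by rewrite /N; ring.
    by rewrite e1 e2; ring.
  have l1 : l ^+ 2 - 1 = 0.
    by move/eqP: H1; rewrite mulf_eq0 (gt_eqF N0) orbF => /eqP.
  have H2 : 2 * l * N = 0.
    have -> : 2 * l * N = 2 * l * w.2 * w.2 + 2 * l * w.1 * w.1 by rewrite /N; ring.
    have -> : 2 * l * w.1 = - ((l ^+ 2 - 1) * w.2) by rewrite e2 opprK.
    by rewrite -e1 l1; ring.
  have l0 : 2 * l = 0.
    by move/eqP: H2; rewrite mulf_eq0 (gt_eqF N0) orbF => /eqP.
  have : l = 0 by lra.
  by move=> l00; move: l1; rewrite l00; lra.
move/eqP; rewrite mulf_eq0 (gt_eqF N0) orbF sqrf_eq0 => /eqP.
by have := sqr_ge0 l; lra.
Qed.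

Lemma circle_param_norm l : `|circle_param l - c| = k.
Proof.
rewrite /circle_param addrC addKr normrZ ger0_norm.
  by rewrite divfK// normr_eq0.
by rewrite divr_ge0// ltW.
Qed.

Lemma circle_param_continuous : continuous circle_param.
Proof.
have cg : continuous g.
  have cx x : continuous (fun l : R => (l ^+ 2 - 1) * x).
    move=> l; apply: cvgMr_tmp.
    by apply: cvgB; [exact: exprn_continuous|exact: cvg_cst].
  have cy y : continuous (fun l : R => 2 * l * y).
    by move=> l; apply: cvgMr_tmp; apply: cvgMl_tmp; exact: cvg_id.
  have c1 : continuous (fun l : R => (l ^+ 2 - 1) * w.1 - 2 * l * w.2).
    by move=> l; apply: cvgB; [exact: cx|exact: cy].
  have c2 : continuous (fun l : R => (l ^+ 2 - 1) * w.2 + 2 * l * w.1).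
    by move=> l; apply: cvgD; [exact: cx|exact: cy].
  by move=> l; exact: (cvg_pair (c1 l) (c2 l)).
move=> l; apply: cvgD; first exact: cvg_cst.
apply: cvgZ; last exact: cg.
apply: cvgMl_tmp; apply: cvgV; first by rewrite normr_eq0.
by apply: cvg_norm; exact: cg.
Qed.

(** If (l + i)^2 is a positive real, its imaginary part forces [l = 0], but then it equals -1. *)
Lemma circle_param_neq l : circle_param l <> c + w.
Proof.
move=> /addrI E; have [m m0 {}E] : exists2 m, 0 < m & m *: g l = w.
  by exists (k / `|g l|); first by rewrite divr_gt0// normr_gt0.
have e1 : m * (g l).1 = w.1 by rewrite -[in RHS]E.
have e2 : m * (g l).2 = w.2 by rewrite -[in RHS]E.
have H : m * (l ^+ 2 - 1) * N = N.
  by rewrite {2}/N !expr2 -{1}e1 -{1}e2 /g /N /=; ring.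
have H' : m * (2 * l) * N = 0.
  have -> : m * (2 * l) * N = m * (g l).2 * w.1 - m * (g l).1 * w.2.
    by rewrite /g /N /=; ring.
  by rewrite e1 e2; ring.
have l0 : l = 0.
  move/eqP: H'; rewrite !mulf_eq0 (gt_eqF N0) (gt_eqF m0) orbF /=.
  by rewrite pnatr_eq0 /= => /eqP.
have := mulr_gt0 m0 N0; have := N0.
by move: H; rewrite l0 expr0n /= sub0r mulrN1 mulNr; lra.
Qed.

(** One looks for (l + i)^2 positively proportional to D / w, that is, to p + i b, the product of D
    with the conjugate of w. For b = 0 the equal norms leave only D = -w, reached at [l = 0]. *)
Lemma circle_param_surj z : `|z - c| = k -> z <> c + w ->
  exists l, circle_param l = z.
Proof.
move=> zk zw; set D := z - c in zk.
suff [l [m m0 gE]] : exists l, exists2 m, 0 < m & g l = m *: D.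
  exists l; rewrite /circle_param gE normrZ zk gtr0_norm// scalerA.
  rewrite (_ : k / (m * k) * m = 1); last by field; rewrite !gt_eqF.
  by rewrite scale1r addrC subrK.
have DE : D != w by apply/eqP => E; apply: zw; rewrite -E addrC subrK.
pose p := D.1 * w.1 + D.2 * w.2; pose b := D.2 * w.1 - D.1 * w.2.
have D1 : N * D.1 = p * w.1 - b * w.2 by rewrite /N /p /b; ring.
have D2 : N * D.2 = p * w.2 + b * w.1 by rewrite /N /p /b; ring.
have [b0|b0] := eqVneq b 0.
  have wD : w = (N / p) *: D /\ p != 0.
    have p0 : p != 0.
      apply/eqP => p0; have D0 : D = 0.
        rewrite [D]surjective_pairing; congr pair; apply: (mulfI (lt0r_neq0 N0)).
          by rewrite D1 b0 p0 !mul0r subr0 mulr0.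
        by rewrite D2 b0 p0 !mul0r addr0 mulr0.
      by move: zk k0; rewrite D0 normr0 => <-; rewrite ltxx.
    have w1 : w.1 = N / p * D.1 by rewrite mulrAC D1 b0; field.
    have w2 : w.2 = N / p * D.2 by rewrite mulrAC D2 b0; field.
    by split=> //; rewrite [w]surjective_pairing {1}w1 {1}w2.
  case: wD => wD p0.
  have Np : `|N / p| = 1.
    apply: (mulIf (lt0r_neq0 k0)); rewrite -{1}zk -normrZ -wD wk mul1r//.
  exists 0; exists (- (N / p)).
    have [|H] := ltP (N / p) 0; first by rewrite oppr_gt0.
    move: Np; rewrite ger0_norm// => E; move: DE; rewrite wD E scale1r eqxx//.
  rewrite scaleNr -wD /g; congr pair => /=; ring.
have N' : N != 0 by rewrite gt_eqF.
(* With q the modulus of p + i b, the number (p + q) + i b has half its argument; dividing by b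
   gives l + i. *)
pose q := Num.sqrt (p ^+ 2 + b ^+ 2).
have q2 : q ^+ 2 = p ^+ 2 + b ^+ 2 by rewrite sqr_sqrtr// addr_ge0// sqr_ge0.
have pq : 0 < p + q.
  have b2 : 0 < b ^+ 2 by rewrite exprn_even_gt0.
  have q0 : 0 <= q by rewrite sqrtr_ge0.
  nra.
pose l := (p + q) / b.
have lE : b * (l ^+ 2 - 1) = 2 * p * l.
  apply: (mulfI b0); rewrite /l.
  have -> : b * (b * (((p + q) / b) ^+ 2 - 1)) = (p + q) ^+ 2 - b ^+ 2 by field.
  have -> : b * (2 * p * ((p + q) / b)) = 2 * p * (p + q) by field.
  have -> : b ^+ 2 = q ^+ 2 - p ^+ 2 by rewrite q2; ring.
  ring.
have lE' : l ^+ 2 - 1 = 2 * l / b * p by apply: (mulfI b0); rewrite lE; field.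
exists l, (2 * l / b * N).
  rewrite mulr_gt0// (_ : 2 * l / b = 2 * (p + q) / b ^+ 2); last by rewrite /l; field.
  by rewrite divr_gt0 ?exprn_even_gt0// mulr_gt0.
have G1 : (l ^+ 2 - 1) * w.1 - 2 * l * w.2 = 2 * l / b * N * D.1.
  have -> : 2 * l / b * N * D.1 = 2 * l / b * (N * D.1) by ring.
  by rewrite D1 lE'; field.
have G2 : (l ^+ 2 - 1) * w.2 + 2 * l * w.1 = 2 * l / b * N * D.2.
  have -> : 2 * l / b * N * D.2 = 2 * l / b * (N * D.2) by ring.
  by rewrite D2 lE'; field.
by rewrite /g G1 G2.
Qed.

End circle.

(** * Neighbourhoods in maximal planar graphs *)

(** Pigeonhole on [#|I|.+1] distinct points of one side of the square that is the sphere of the max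
    norm. *)
Lemma sphere_avoid (R : realType) (I : finType) (a : I -> R * R) c k : 0 < k ->
  exists2 w, `|w| = k & forall i, a i <> c + w.
Proof.
move=> k0; pose w (j : 'I_#|I|.+1) : R * R := (k / j.+1%:R, k).
have wk j : `|w j| = k.
  rewrite prod_normE /= !ger0_norm ?divr_ge0 ?(ltW k0)//.
  by apply/max_idPr; rewrite ler_pdivrMr// ler_peMr ?(ltW k0)// ler1n.
apply: contrapT => H.
have /choice[g gP] : forall j, exists i, a i = c + w j.
  move=> j; apply: contrapT => nj; apply: H; exists (w j) => // i E.
  by apply: nj; exists i.
have gi : injective g.
  move=> j j' E; have := gP j; rewrite E gP => /addrI[/(mulfI (lt0r_neq0 k0))/invr_inj].
  by move/eqP; rewrite eqr_nat => /eqP[] /val_inj.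
by have := leq_card g gi; rewrite card_ord ltnn.
Qed.

Lemma is_arc_ends (R : realType) (a b : R * R) A : is_arc a b A -> A a /\ A b.
Proof.
move=> /is_arc_path[f [_ _ <- <- ->]].
by split; [exists 0|exists 1]; rewrite //= in_itv /= lexx ler01.
Qed.

Lemma is_arc_closed (R : realType) (a b : R * R) A : is_arc a b A -> closed A.
Proof. by move=> /is_arc_path[f [cf _ _ _ ->]]; exact: image_itv_closed. Qed.

Section link.
Variables (R : realType) (T : finType) (e : rel T).
Hypotheses (e_simple : simple_graph e) (e_nbr : forall x, exists y, e x y).

Lemma off_curves_open pos curve : @plane_drawing R T e pos curve ->
  forall z, off_curves e curve z ->
  exists2 d, 0 < d & forall w, `|z - w| < d -> off_curves e curve w.
Proof.
move=> [_ arcs _ _] z zo.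
have [[x y]|i d d' d'0 dd' H exy w wd|d d0 dP] := @finite_uniform R _
    (fun (i : T * T) d => e i.1 i.2 -> forall w, `|z - w| < d ->
      ~ curve [set i.1; i.2]%SET w).
- have [exy|] := boolP (e x y); last by exists 1.
  have /is_arc_closed := arcs x y exy.
  rewrite -openC openE => /(_ z (zo x y exy))/nbhs_normP[d /= d0 dP].
  by exists d => // _ w wd; exact: (dP w).
- by apply: H => //; exact: lt_le_trans dd'.
- by exists d => // w wd x y exy; exact: (dP (x, y)).
Qed.

(** Every vertex has a neighbour and so lies on some curve; an arc off the curves therefore avoids
    all vertices but its ends. *)
Lemma add_edge_planar pos curve p q : @plane_drawing R T e pos curve -> p <> q ->
  arcin [set z | [\/ z = pos p, z = pos q | off_curves e curve z]] (pos p) (pos q) ->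
  planar R (add_edge e p q).
Proof.
move=> dr pq; case: (dr) => pos_inj arcs avoid meet.
move=> /arcin_is_arc[]; first by move/pos_inj.
move=> A arcA AZ; case: e_simple => sym _.
exists pos, (fun E => if E == [set p; q]%SET then A else curve E).
have old x y : add_edge e p q x y -> ([set x; y] == [set p; q])%SET = false -> e x y.
  rewrite /add_edge /= => /or3P[//|/andP[/eqP-> /eqP->]|/andP[/eqP-> /eqP->]].
    by rewrite eqxx.
  by rewrite finset.setUC eqxx.
have new x y : [set x; y]%SET = [set p; q]%SET -> x = p /\ y = q \/ x = q /\ y = p.
  move=> E; have : x \in [set p; q]%SET by rewrite -E !inE eqxx.
  have : y \in [set p; q]%SET by rewrite -E !inE eqxx orbT.
  have : p \in [set x; y]%SET by rewrite E !inE eqxx.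
  have : q \in [set x; y]%SET by rewrite E !inE eqxx orbT.
  rewrite !inE => /orP[]/eqP q1 /orP[]/eqP p1 /orP[]/eqP y1 /orP[]/eqP x1;
    subst => //; tauto.
have pos_on z : ~ off_curves e curve (pos z).
  have [y ezy] := e_nbr z; move=> /(_ z y ezy); apply.
  by have [] := is_arc_ends (arcs _ _ ezy).
have A_pos z : A (pos z) -> z = p \/ z = q.
  by case/AZ => [/pos_inj->|/pos_inj->|/pos_on//]; [left|right].
have A_curve x y w : e x y -> A w -> curve [set x; y]%SET w ->
    exists z, [/\ z = p \/ z = q, z = x \/ z = y & w = pos z].
  move=> exy Aw cw; case: (AZ w Aw) => [E|E|/(_ x y exy)//].
    by exists p; split => //; [left|apply: avoid; rewrite // -E].
  by exists q; split => //; [right|apply: avoid; rewrite // -E].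
split=> //.
- move=> x y exy; case: ifP => [/eqP/new[][-> ->]//|/(old _ _ exy)]; last exact: arcs.
  exact: is_arc_sym.
- move=> x y z exy; case: ifP => [/eqP/new[][-> ->]/A_pos|/(old _ _ exy)]; last exact: avoid.
    by [].
  by tauto.
- move=> x y u v exy euv; case: ifP => [/eqP xyE|/(old _ _ exy) {}exy];
    case: ifP => [/eqP uvE|/(old _ _ euv) {}euv] nE w [H1 H2].
  + by case: nE; rewrite xyE uvE.
  + have [z [zp zu ->]] := A_curve u v w euv H1 H2.
    by exists z => //; split => //=; case: (new _ _ xyE) => -[-> ->]; tauto.
  + have [z [zp zu ->]] := A_curve x y w exy H2 H1.
    by exists z => //; split => //=; case: (new _ _ uvE) => -[-> ->]; tauto.
  + exact: (meet x y u v exy euv nE w (conj H1 H2)).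
Qed.

(* Around [s], the set of points that see a neighbour in [P] is clopen in the
   circle deprived of the direction of [t]. *)
Lemma link_crossing (s t p0 q0 : T) (P : T -> Prop) :
  maximal_planar R e -> e s p0 -> e s q0 -> p0 <> t -> q0 <> t -> P p0 -> ~ P q0 ->
  exists p q, [/\ e s p /\ p <> t, e s q /\ q <> t, P p, ~ P q & e p q].
Proof.
move=> [[pos' [curve' dr']] maxe] sp0 sq0 p0t q0t Pp0 Pq0; apply: contrapT => nH.
case: (e_simple) => sym irr.
have [pos [curve [a [k [d [dr [k0 d0 far] aP on see]]]]]] := star_drawing s e_simple dr'.
case: (dr) => pos_inj arcs avoid meet.
pose Z p : set (R * R) := [set z | z = pos p \/ off_curves e curve z].
(* A point seeing both [p] and [q] would give an arc for a new edge; maximality forbids this, as [p]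
   and [q] are not adjacent by [nH]. *)
have noarc p q : e s p -> e s q -> p <> t -> q <> t -> P p -> ~ P q ->
    ~ exists z, arcin (Z p) z (pos p) /\ arcin (Z q) z (pos q).
  move=> sp sq pt qt Pp Pq [z [zp zq]].
  have pq : p <> q by move=> pq; apply: Pq; rewrite -pq.
  have npq : ~~ e p q by apply/negP => epq; apply: nH; exists p, q.
  apply: (maxe p q) => //; first exact/eqP.
  apply: add_edge_planar dr pq _; apply: (@arcin_trans _ _ _ _ z).
    apply: arcin_sym; apply: sub_arcin zp => w [->|wo].
      by apply: Or31.
    by apply: Or33.
  apply: sub_arcin zq => w [->|wo]; first by apply: Or32.
  by apply: Or33.
have ps p : e s p -> p != s by move=> sp; apply/eqP => E; rewrite E irr in sp.
have a_Z p q : e s p -> e s q -> ~ Z q (a p).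
  move=> sp sq [E|]; last by move=> /(_ s p sp); apply; case: (aP p sp).
  have := far q (ps q sq); rewrite -E; have [-> _ _] := aP p sp.
  by rewrite ltxx.
have a_arc p q : e s p -> e s q -> ~ arcin (Z q) (a p) (pos q).
  by move=> sp sq /arcin_l; exact: a_Z.
(* The puncture of the circle: the direction of the edge [st] if there is one, otherwise a direction
   off all edges at [s]. *)
have [w wk wa] : exists2 w, `|w| = k &
    (forall p, e s p -> (a p = pos s + w <-> p = t)).
  have [st|nst] := boolP (e s t).
    have [atk _ ainj] := aP t st.
    exists (a t - pos s) => // p sp; rewrite [pos s + _]addrC subrK.
    by split=> [E|-> //]; have [_ _ /(_ t st E)] := aP p sp.
  have [w wk wa] := sphere_avoid a (pos s) k0.
  by exists w => // p sp; split=> [/wa//|pt]; rewrite -pt sp in nst.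
pose z := circle_param (pos s) k w.
have zk l : `|z l - pos s| = k by exact: circle_param_norm.
have zneq l : z l <> pos s + w by exact: circle_param_neq.
have surj p : e s p -> p <> t -> exists l, z l = a p.
  move=> sp pt; apply: circle_param_surj => //; first by case: (aP p sp).
  by move=> /(wa p sp).
pose S l := exists p, [/\ e s p, p <> t, P p & z l = a p \/ arcin (Z p) (z l) (pos p)].
have notS l q : e s q -> q <> t -> ~ P q ->
    z l = a q \/ arcin (Z q) (z l) (pos q) -> ~ S l.
  move=> sq qt nPq Hq [p [sp pt Pp [zp|zp]]].
    case: Hq => [zq|]; last by rewrite zp; exact: a_arc.
    have [_ _ /(_ q sq)] := aP p sp; rewrite -zp zq => /(_ erefl) E.
    by apply: nPq; rewrite -E.
  case: Hq => [zq|zq]; first by move: zp; rewrite zq; exact: a_arc.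
  by apply: (noarc p q) => //; exists (z l).
have [lp lpE] := surj p0 sp0 p0t; have [lq lqE] := surj q0 sq0 q0t.
suff : S lq by apply: (notS lq q0) => //; left.
apply: (@locally_constant_line _ _ lp) => [|l]; first by exists p0; split => //; left.
have cz : continuous z by exact: circle_param_continuous.
(* If [z l] is on the edge to [p], all nearby points are [a p] or see [p], so [P p] decides
   membership in [S]. Otherwise [z l] is off the drawing and short segments join it to its
   neighbours on the circle. *)
have [[p sp zp]|nzp] := pselect (exists2 p, e s p & z l = a p).
  have /continuousP_eps/(_ l _ d0)[d' d'0 d'P] := cz.
  have pt : p <> t by move=> /(wa p sp); rewrite -zp; exact: zneq.
  have near l' : `|l - l'| < d' -> z l' = a p \/ arcin (Z p) (z l') (pos p).
    move=> /d'P ll'; have [->|ne] := pselect (z l' = a p); [by left|right].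
    by apply: see => //; rewrite distrC -zp.
  exists d' => // l' ll'; have [Pp|nPp] := pselect (P p).
    split=> _; exists p; split=> //; [exact: near|by left].
  by split=> H; exfalso; [apply: (notS l p) H|apply: (notS l' p) H] => //; [left|exact: near].
have zo : off_curves e curve (z l).
  by apply: contrapT => /(on _ (zk l)).
have [d' d'0 d'P] := off_curves_open dr zo.
have /continuousP_eps/(_ l _ d'0)[d2 d20 d2P] := cz.
exists d2 => // l' /d2P ll'.
have zo' : off_curves e curve (z l') by exact: d'P.
have zz p : arcin (Z p) (z l) (z l').
  apply: arcin_seg => u u1; right; apply: d'P.
  rewrite opprD addrA subrr sub0r normrN normrZ distrC ger0_norm; last by lra.
  by apply: le_lt_trans ll'; rewrite ler_piMl//; lra.
have noa p l'' : e s p -> off_curves e curve (z l'') -> z l'' <> a p.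
  by move=> sp zo'' E; apply: (zo'' s p sp); rewrite E; case: (aP p sp).
split=> -[p [sp pt Pp [/noa|zp]]]; try by case.
- exists p; split => //; right; exact: arcin_trans (arcin_sym (zz p)) zp.
- exists p; split => //; right; exact: arcin_trans (zz p) zp.
Qed.

End link.

(** * Distance layers *)

Local Close Scope classical_set_scope.

Section distance.
Local Open Scope nat_scope.
Variables (T : finType) (e : rel T).
Hypotheses (e_sym : symmetric e) (e_conn : connected_graph e).
Local Notation d := (graph_dist e).

Lemma dist_le_size x p : path e x p -> d x (last x p) <= size p.
Proof.
move=> xp; rewrite leqNgt; apply/negP => lt.
(* The search never returns more than [#|T|], so [size p] is among the lengths tried. *)
have ltT : size p < #|T|.
  apply: leq_trans lt _; rewrite -[X in _ <= X](size_iota 0); exact: find_size.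
have := before_find 0 lt; rewrite nth_iota// add0n => /negbT/negP; apply.
by rewrite /walk; apply/existsP; exists (in_tuple p); rewrite /= xp eqxx.
Qed.

Lemma dist_path x y : exists p, [/\ path e x p, last x p = y & size p = d x y].
Proof.
have hasw : has (fun k => walk e k x y) (iota 0 #|T|).
  have /connectP[p xp ->] := e_conn x y.
  case/shortenP: xp => p' xp' up' _; apply/hasP; exists (size p').
    rewrite mem_iota /= add0n; have := max_card (mem (x :: p')).
    by rewrite (card_uniqP up').
  by rewrite /walk; apply/existsP; exists (in_tuple p'); rewrite /= xp' eqxx.
have := nth_find 0 hasw; rewrite nth_iota ?add0n; last first.
  by rewrite -[X in _ < X](size_iota 0) -has_find.
by move=> /= /existsP[p /andP[xp /eqP lp]]; exists p; rewrite size_tuple.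
Qed.

Lemma dist0 x : d x x = 0.
Proof. by apply/eqP; rewrite -leqn0; exact: (@dist_le_size x [::]). Qed.

Lemma dist_triangle y x z : d x z <= d x y + d y z.
Proof.
have [p [xp py <-]] := dist_path x y; have [q [yq qz <-]] := dist_path y z.
have := @dist_le_size x (p ++ q); rewrite cat_path xp py yq last_cat py qz size_cat.
exact.
Qed.

Lemma dist_edge x y : e x y -> d x y <= 1.
Proof. by move=> xy; apply: (@dist_le_size x [:: y]); rewrite /= xy. Qed.

Lemma dist_sym x y : d x y = d y x.
Proof.
suff H u w : d u w <= d w u by apply/eqP; rewrite eqn_leq !H.
have [p [wp pu <-]] := dist_path w u.
have := @dist_le_size u (rev (belast w p)).
rewrite size_rev size_belast => /(_ _)/wrap[].
  rewrite -pu rev_path; apply: sub_path wp => a b; by rewrite e_sym.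
by case: p wp pu => [|b p] _ /= <-; rewrite ?rev_cons ?last_rcons.
Qed.

Lemma dist_geodesic x y i : i <= d x y -> exists z, d x z = i /\ d x y = i + d z y.
Proof.
move=> ixy; have [p [xp py sp]] := dist_path x y.
exists (last x (take i p)); set z := last x _.
have szt : size (take i p) = i by rewrite size_take sp; case: ltngtP ixy.
move: xp py; rewrite -{1 2}(cat_take_drop i p) cat_path last_cat => /andP[p1 p2] py.
have le1 := dist_le_size p1; have le2 := dist_le_size p2.
rewrite -/z py szt size_drop sp in le1 le2.
have := dist_triangle z x y; lia.
Qed.

Lemma dist_edge_lip v x y : e x y -> d v y <= (d v x).+1.
Proof. by move=> /dist_edge; have := dist_triangle x v y; lia. Qed.

Lemma dist_ecc v w : d v w <= eccentricity e v.
Proof. exact: leq_bigmax. Qed.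

Lemma ecc_attained v : exists w, d v w = eccentricity e v.
Proof.
have [|w wE] := @bigop.eq_bigmax T (d v); first by apply/card_gt0P; exists v.
by exists w.
Qed.

Lemma radius_le v : graph_radius e <= eccentricity e v.
Proof.
rewrite /graph_radius; have := mem_index_enum v.
elim: (index_enum T) => // x s IH; rewrite in_cons big_cons geq_min.
by case: eqVneq => [->|_ /= /IH ->]; rewrite ?leqnn ?orbT.
Qed.

End distance.

(** * Arithmetic of the distance sum *)

Lemma leq_sum_range m n (F G : nat -> nat) :
  (forall j, (m <= j < n)%N -> (F j <= G j)%N) ->
  (\sum_(m <= j < n) F j <= \sum_(m <= j < n) G j)%N.
Proof. by move=> H; rewrite big_nat [leqRHS]big_nat; exact: leq_sum. Qed.

(** Here [r + s] is the eccentricity, [S] the sum of [3 * j] below it, [Q] the contribution of the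
    layers below the last and [X] that of the last. For [r] small against [s], three vertices per
    layer suffice. *)
Lemma thin_arith (r s S X Q : nat) :
  (2 * S = 3 * ((r + s) * (r + s).-1))%N ->
  (r + s <= X)%N -> (S <= Q)%N -> (r <= 2 * s + 5)%N ->
  (6 * r ^ 2 <= 2 * (Q + X) + 18 * r)%N.
Proof.
move=> h1 h2 h3 h4.
have h5 : ((r + s) * (r + s).-1 + (r + s) = r * r + 2 * (r * s) + s * s)%N.
  have [E|p] := posnP (r + s)%N; last by rewrite -mulnSr prednK//; ring.
  by have [-> ->] : r = 0%N /\ s = 0%N by lia.
have h6 : (r * r <= 2 * (r * s) + 5 * r)%N.
  by have := leq_mul (leqnn r) h4; rewrite mulnDr mulnCA (mulnC r 5).
have h7 : (s <= s * s)%N by case: (s) => // k; rewrite leq_pmulr.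
rewrite -mulnn; lia.
Qed.
(** As before, with a second sum [C] of [3 * j] over the middle layers, from [s + 3] to [A]. The
    term [A] on the right pays for layer [A], known to have 5 vertices instead of 6. *)
Lemma thick_arith (r s S X Q C A : nat) :
  (2 * S = 3 * ((r + s) * (r + s).-1))%N ->
  (r + s <= X)%N -> (A + s + 3 = r)%N -> (s.+2 <= A)%N ->
  (2 * C + 3 * (s.+2 * s.+3) = 3 * (A * A.+1))%N -> (S + C <= Q + A)%N ->
  (6 * r ^ 2 <= 2 * (Q + X) + 18 * r)%N.
Proof.
move=> h1 h2 h4 h4' hC hQ.
have h5 : ((r + s) * (r + s).-1 + (r + s) = r * r + 2 * (r * s) + s * s)%N.
  have [E|p] := posnP (r + s)%N; last by rewrite -mulnSr prednK//; ring.
  by have [-> ->] : r = 0%N /\ s = 0%N by lia.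
have h7 : (s <= s * s)%N by case: (s) => // k; rewrite leq_pmulr.
have e1 : (s.+2 * s.+3 = s * s + 5 * s + 6)%N by ring.
have e2 : (A * A.+1 = A * A + A)%N by ring.
have e3 : (r * s = A * s + s * s + 3 * s)%N by rewrite -h4; ring.
have e4 : (r * r = A * A + s * s + 9 + 2 * (A * s) + 6 * A + 6 * s)%N by rewrite -h4; ring.
rewrite -mulnn; lia.
Qed.

(** * Gates and sizes of distance layers *)

Section layers.
Local Open Scope nat_scope.
Variables (T : finType) (e : rel T).
Hypotheses (e_sym : symmetric e) (e_irr : irreflexive e).
Hypothesis e_conn : connected_graph e.
Local Notation d := (graph_dist e).

(** All that the layer argument uses of maximal planarity. *)
Hypothesis link : forall (s t p0 q0 : T) (P : T -> Prop),
  e s p0 -> e s q0 -> p0 <> t -> q0 <> t -> P p0 -> ~ P q0 ->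
  exists p q, [/\ e s p /\ p <> t, e s q /\ q <> t, P p, ~ P q & e p q].

Variable v : T.
Let D := eccentricity e v.
Let r := graph_radius e.

Definition layer j : {set T} := [set x | d v x == j]%SET.
(* The vertices of a layer through which one proceeds to the next one. *)
Definition gate j : {set T} :=
  [set x in layer j | [exists y, e x y && (d v y == j.+1)]]%SET.

Lemma gateP j x : reflect (d v x = j /\ exists2 y, e x y & d v y = j.+1) (x \in gate j).
Proof.
rewrite !inE; apply: (iffP andP) => [[/eqP -> /existsP[y /andP[xy /eqP yj]]]|[-> [y xy yj]]].
  by split => //; exists y.
by split => //; apply/existsP; exists y; rewrite xy yj eqxx.
Qed.

Lemma sub_gate j : gate j \subset layer j.
Proof. by apply/fintype.subsetP => x; rewrite inE => /andP[]. Qed.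

Lemma gate_reach j x : j < d v x -> exists2 c, c \in gate j & d v x = j + d c x.
Proof.
move=> jx; have [c [cj cx]] := dist_geodesic e_conn (ltnW jx).
exists c => //; apply/gateP; split => //.
have [y [cy yx]] : exists y, d c y = 1 /\ d c x = 1 + d y x.
  by apply: dist_geodesic => //; lia.
have ecy : e c y.
  have [[|z [|z' p]] [cp py sp]] := dist_path e_conn c y; rewrite cy in sp => //.
  by move: cp py => /= /andP[+ _] <-.
exists y => //; have := dist_edge_lip e_conn v ecy.
have := dist_triangle e_conn y v x; lia.
Qed.

Lemma gate_nonempty j : j < D -> exists c, c \in gate j.
Proof.
have [w wD] := ecc_attained e v; rewrite /D -wD.
by move=> /gate_reach[c cg _]; exists c.
Qed.

(** Among the neighbours of [x], separate distances at most [j] from larger ones. An edge crossing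
    this cut goes from layer [j] to layer [j.+1], so its lower end is in the gate. *)
Lemma gate_degree j x : 0 < j -> x \in gate j -> 1 < #|[set y in gate j | e x y]%SET|.
Proof.
move=> j0 /gateP[xj [q0 xq0 q0j]].
have [p0 xp0 p0j] : exists2 p0, e x p0 & (d v p0).+1 = j.
  have [|c [cj cx]] := @dist_geodesic T e e_conn v x j.-1; first by lia.
  exists c; last lia.
  have [[|z [|z' p]] [cp py sp]] := dist_path e_conn c x; try (move: sp => /=; lia).
  by move: cp py => /= /andP[+ _] <-; rewrite e_sym.
have step t : d v t = j -> exists2 p, p \in gate j & e x p /\ p <> t.
  move=> tj; have [|||//|p [q [[xp pt] [xq qt] Pp Pq pq]]] :=
    @link x t p0 q0 (fun z => d v z <= j) xp0 xq0.
  - by move=> E; subst t; lia.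
  - by move=> E; subst t; lia.
  - by lia.
  - by lia.
  exists p => //; apply/gateP.
  have := dist_edge_lip e_conn v pq; have := dist_edge_lip e_conn v xq => H1 H2.
  by split; [lia|exists q => //; lia].
(* Deleting [x], not its own neighbour, gives a first gate neighbour; deleting that one gives a
   second. *)
have [p1 g1 [xp1 _]] := step x xj.
have [p2 g2 [xp2 p12]] := step p1 (proj1 (gateP _ _ g1)).
have -> : 2 = #|[set p1; p2]%SET| by rewrite cards2 eq_sym (introN eqP p12).
apply: subset_leq_card; apply/fintype.subsetP => z.
by rewrite !inE => /orP[]/eqP->; rewrite ?xp1 ?xp2 ?andbT; move: g1 g2; rewrite !inE.
Qed.

Lemma gate_nbrs j c :
  [set y in gate j | e c y]%SET \subset (gate j :\ c)%SET.
Proof.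
apply/fintype.subsetP => y.
by rewrite !inE => /andP[-> cy]; rewrite andbT; apply: contraTneq cy => ->; rewrite e_irr.
Qed.

Lemma gate_card j : 0 < j -> j < D -> 2 < #|gate j|.
Proof.
move=> j0 /gate_nonempty[c cg]; have := gate_degree j0 cg.
have := subset_leq_card (gate_nbrs j c); have := cardsD1 c (gate j); rewrite cg.
lia.
Qed.

Lemma gate_dist1 j c c' : 0 < j -> #|gate j| <= 3 -> c \in gate j -> c' \in gate j ->
  d c c' <= 1.
Proof.
move=> j0 g3 cg cg'; have [<-|cc] := eqVneq c c'; first by rewrite dist0.
have /eqP E : [set y in gate j | e c y]%SET == (gate j :\ c)%SET.
  rewrite eqEcard gate_nbrs /=; have := gate_degree j0 cg.
  have := cardsD1 c (gate j); rewrite cg; lia.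
apply: dist_edge; have : c' \in (gate j :\ c)%SET by rewrite in_setD1 eq_sym cc.
by rewrite -E finset.in_set => /andP[].
Qed.

(** Two nonadjacent gate vertices have at least two gate neighbours each among at most three others,
    hence a common one. *)
Lemma gate_dist2 j c c' : 0 < j -> #|gate j| <= 5 -> c \in gate j -> c' \in gate j ->
  d c c' <= 2.
Proof.
move=> j0 g5 cg cg'; have [<-|cc] := eqVneq c c'; first by rewrite dist0.
have [ecc|necc] := boolP (e c c'); first by apply: leq_trans (dist_edge ecc) _.
pose A := [set y in gate j | e c y]%SET; pose B := [set y in gate j | e c' y]%SET.
have cA : 1 < #|A| := gate_degree j0 cg.
have cB : 1 < #|B| := gate_degree j0 cg'.
have sAB : (A :|: B)%SET \subset (gate j :\ c :\ c')%SET.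
  apply/fintype.subsetP => y; rewrite finset.in_setU !in_setD1 !finset.in_set.
  by move=> /orP[]/andP[/andP[-> ->] ey]; rewrite !andbT;
    apply/andP; split; apply: contraTneq ey => ->; rewrite ?e_irr// e_sym.
have cAB : #|(A :&: B)%SET| != 0.
  have := subset_leq_card sAB; have := cardsUI A B.
  have := cardsD1 c' (gate j :\ c)%SET; have := cardsD1 c (gate j).
  rewrite in_setD1 eq_sym cc cg cg' /=; lia.
have [y] : exists y, y \in (A :&: B)%SET.
  by apply/set0Pn; rewrite -cards_eq0.
rewrite finset.in_setI !finset.in_set => /andP[/andP[_ cy] /andP[_ cy']].
have := dist_triangle e_conn y c c'; have := dist_edge cy.
by rewrite e_sym in cy'; have := dist_edge cy'; lia.
Qed.

(** Take [u] at distance [i] from [v] on a geodesic to [c]. Going to [x] through [c] and [c'] saves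
    [i] and loses at most [t]. *)
Lemma gate_center j i t c : i <= j -> c \in gate j ->
  (forall c', c' \in gate j -> d c c' <= t) ->
  exists u, (forall x, d u x <= i + d v x) /\
    (forall x c', c' \in gate j -> d v x = j + d c' x -> d u x + i <= d v x + t).
Proof.
move=> ij cg ct; have [cj _] := gateP _ _ cg.
have [u [ui uc]] : exists u, d v u = i /\ d v c = i + d u c.
  by apply: dist_geodesic => //; rewrite cj.
exists u; split=> [x|x c' c'g xE].
  by have := dist_triangle e_conn v u x; rewrite (dist_sym e_sym e_conn u v) ui.
have := dist_triangle e_conn c u x; have := dist_triangle e_conn c' c x.
have := ct c' c'g; lia.
Qed.

(** Otherwise [gate_center] with [i = s + 3] and [t = 2] gives a vertex at distance at most
    [D + 2 - (s + 3) = r - 1] from everything beyond layer [j], and at most [s + 3 + j < r] from the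
    rest. *)
Lemma layer_thick6 s j : D = r + s -> s + 3 <= j -> j + s + 4 <= r -> 5 < #|layer j|.
Proof.
move=> Ds sj jr; rewrite ltnNge; apply/negP => l5.
have g5 : #|gate j| <= 5 by apply: leq_trans (subset_leq_card (sub_gate j)) l5.
have [c cg] : exists c, c \in gate j by apply: gate_nonempty; lia.
have [u [u1 u2]] := gate_center sj cg
  (fun c' => @gate_dist2 j c c' ltac:(lia) g5 cg).
have [w uw] := ecc_attained e u; have := radius_le e u; have := dist_ecc e v w.
rewrite -uw -/D -/r => wD rw.
have [wj|/gate_reach[c' c'g xE]] := leqP (d v w) j.
  by have := u1 w; lia.
by have := u2 w c' c'g xE; lia.
Qed.

(** Now [s + 3 + j = r], so the previous bound fails on layer [j] itself. This is harmless if the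
    whole layer is the gate. If not, the gate has at most 3 vertices, pairwise adjacent, and
    [i = s + 2], [t = 1] work. *)
Lemma layer_thick5 s j : D = r + s -> s + 3 <= j -> j + s + 3 = r -> 4 < #|layer j|.
Proof.
move=> Ds sj jr; rewrite ltnNge; apply/negP => l4.
have [c cg] : exists c, c \in gate j by apply: gate_nonempty; lia.
have [gl|gl] := eqVneq (gate j) (layer j).
  have g5 : #|gate j| <= 5 by rewrite gl; lia.
  have [u [u1 u2]] := gate_center sj cg
    (fun c' => @gate_dist2 j c c' ltac:(lia) g5 cg).
  have [w uw] := ecc_attained e u; have := radius_le e u; have := dist_ecc e v w.
  rewrite -uw -/D -/r => wD rw.
  case: (ltngtP (d v w) j) => [wj|/gate_reach[c' c'g xE]|wj].
  - by have := u1 w; lia.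
  - by have := u2 w c' c'g xE; lia.
  - have wg : w \in gate j by rewrite gl finset.in_set wj.
    by have := u2 w w wg; rewrite dist0 wj; lia.
have g3 : #|gate j| <= 3.
  have : gate j \proper layer j by rewrite finset.properEneq gl sub_gate.
  by move/proper_card; lia.
have sj2 : s + 2 <= j by lia.
have [u [u1 u2]] := gate_center sj2 cg
  (fun c' => @gate_dist1 j c c' ltac:(lia) g3 cg).
have [w uw] := ecc_attained e u; have := radius_le e u; have := dist_ecc e v w.
rewrite -uw -/D -/r => wD rw.
have [wj|/gate_reach[c' c'g xE]] := leqP (d v w) j.
  by have := u1 w; lia.
by have := u2 w c' c'g xE; lia.
Qed.

Lemma sum_dist_layers : \sum_w d v w = \sum_(j < D.+1) j * #|layer j|.
Proof.
rewrite (partition_big (fun w => inord (d v w) : 'I_D.+1) xpredT) //=.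
apply: eq_bigr => j _; rewrite -sum1_card big_distrr /=.
apply: eq_big => [w|w /eqP wj]; last first.
  by rewrite muln1 -wj inordK// ltnS dist_ecc.
by rewrite finset.in_set -val_eqE /= inordK// ltnS dist_ecc.
Qed.

Lemma sum_range A B : B <= A ->
  2 * (\sum_(B.+1 <= j < A.+1) 3 * j) + 3 * (B * B.+1) = 3 * (A * A.+1).
Proof.
elim: A => [|A IH]; first by rewrite leqn0 => /eqP->; rewrite big_geq.
rewrite leq_eqVlt => /orP[/eqP->|BA]; first by rewrite big_geq ?muln0.
by rewrite big_nat_recr//= mulnDr addnAC IH//; lia.
Qed.

Lemma sum_dist_ge : 6 * r ^ 2 <= 2 * (\sum_w d v w) + 18 * r.
Proof.
have rD : r <= D := radius_le e v.
have [s Ds] : exists s, D = r + s by exists (D - r); lia.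
have lD : 0 < D -> 0 < #|layer D|.
  move=> _; have [w wD] := ecc_attained e v.
  by apply/card_gt0P; exists w; rewrite finset.in_set wD.
have l3 j : 0 < j -> j < D -> 2 < #|layer j|.
  by move=> j0 jD; apply: leq_trans (gate_card j0 jD) (subset_leq_card (sub_gate j)).
have base : 2 * (\sum_(0 <= j < D) 3 * j) = 3 * ((r + s) * (r + s).-1).
  rewrite -Ds; case: (D) => [|m]; first by rewrite big_geq.
  have H := @sum_range m 0 isT.
  by rewrite big_ltn// muln0 add0n /=; lia.
rewrite sum_dist_layers big_ord_recr /= -(big_mkord xpredT (fun j => j * #|layer j|)).
have DlD : r + s <= D * #|layer D|.
  by rewrite -Ds; case: (posnP D) => [->//|D0]; rewrite leq_pmulr// lD.
have [small|large] := leqP r (2 * s + 5).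
  have : \sum_(0 <= j < D) 3 * j <= \sum_(0 <= j < D) j * #|layer j|.
    apply: leq_sum_range => j /andP[_ jD]; case: (posnP j) => [->//|j0].
    by rewrite mulnC leq_pmul2l// l3.
  by move=> h; exact: thin_arith base DlD h small.
(* The last layer covered by [layer_thick5]; [layer_thick6] covers layers [s + 3] to [A - 1]. *)
pose A := r - s - 3.
have range := @sum_range A s.+2 ltac:(rewrite /A; lia).
suff h : \sum_(0 <= j < D) 3 * j + \sum_(s.+3 <= j < A.+1) 3 * j <=
    \sum_(0 <= j < D) j * #|layer j| + A.
  apply: thick_arith base DlD _ _ range h.
    by rewrite /A; lia.
  by rewrite /A; lia.
have AD : A.+1 <= D by rewrite /A; lia.
have sA : s.+3 <= A.+1 by rewrite /A; lia.
have cut (F : nat -> nat) : \sum_(0 <= j < D) F j = \sum_(0 <= j < s.+3) F j +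
    (\sum_(s.+3 <= j < A.+1) F j + \sum_(A.+1 <= j < D) F j).
  rewrite (@big_cat_nat _ _ _ s.+3) //=; last lia.
  by rewrite [X in _ + X](@big_cat_nat _ _ _ A.+1).
rewrite !cut.
have H1 : \sum_(0 <= j < s.+3) 3 * j <= \sum_(0 <= j < s.+3) j * #|layer j|.
  apply: leq_sum_range => j /andP[_ jD]; case: (posnP j) => [->//|j0].
  by rewrite mulnC leq_pmul2l// l3//; lia.
have H2 : \sum_(A.+1 <= j < D) 3 * j <= \sum_(A.+1 <= j < D) j * #|layer j|.
  apply: leq_sum_range => j /andP[jA jD].
  by rewrite mulnC leq_pmul2l ?l3//; lia.
have H3 : \sum_(s.+3 <= j < A.+1) 3 * j + \sum_(s.+3 <= j < A.+1) 3 * j <=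
    \sum_(s.+3 <= j < A.+1) j * #|layer j| + A.
  rewrite !big_nat_recr /=; try (rewrite /A; lia).
  have H4 : \sum_(s.+3 <= j < A) 3 * j + \sum_(s.+3 <= j < A) 3 * j <=
      \sum_(s.+3 <= j < A) j * #|layer j|.
    rewrite -big_split /=; apply: leq_sum_range => j /andP[js jA].
    have L6 := @layer_thick6 s j Ds ltac:(lia) ltac:(move: jA; rewrite /A; lia).
    by rewrite -mulnDl mulnC leq_mul2l L6 orbT.
  have L5 := @layer_thick5 s A Ds ltac:(rewrite /A; lia) ltac:(rewrite /A; lia).
  have : A * 5 <= A * #|layer A| by rewrite leq_mul2l L5 orbT.
  move: H4; lia.
lia.
Qed.

End layers.

(** * From distance sums to radius and proximity *)

Theorem theorem4p1 (R : realType) (T : finType) (e : rel T)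
    (e_simple : simple_graph e) (e_conn : connected_graph e)
    (e_maxplanar : maximal_planar R e) (n_ge4 : (4 <= #|T|)%N) :
  let n : R := #|T|%:R in
  (graph_radius e)%:R - proximity R e <=
    (n + 1) / 12%:R + 4%:R / 3%:R + 27%:R / (4%:R * (n - 1)).
Proof.
cbv zeta; set n : R := #|T|%:R; case: (e_simple) => e_sym e_irr.
have e_nbr x : exists y, e x y.
  have : (0 < #|predC1 x|)%N by rewrite cardC1; lia.
  move=> /card_gt0P[y]; rewrite inE /= => yx.
  have /connectP[[|z p] /= xp yE] := e_conn x y; first by rewrite yE eqxx in yx.
  by exists z; case/andP: xp.
have link s t p0 q0 P := @link_crossing R T e e_simple e_nbr s t p0 q0 P e_maxplanar.
have n4 : 4 <= n by rewrite /n (ler_nat R 4).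
set b := (X in _ <= X).
have b0 : 0 <= b.
  have n1 : 0 <= n - 1 by lra.
  have : 0 <= 27%:R / (4%:R * (n - 1)) by rewrite divr_ge0// mulr_ge0.
  by rewrite /b; move: (_ / (_ * (n - 1))) => t; lra.
suff : (graph_radius e)%:R - b <= proximity R e by lra.
rewrite /proximity; elim/big_ind : _ => [|x y bx yb|v _].
(* The default value [n] of the minimum is harmless, as the radius is at most [n]. *)
- have [v _] : exists v : T, v \in T by apply/card_gt0P; exact: leq_trans n_ge4.
  have : (graph_radius e <= #|T|)%N.
    have [w wE] := ecc_attained e v.
    apply: leq_trans (radius_le e v) _; rewrite -wE /graph_dist.
    by rewrite -[leqRHS](size_iota 0); exact: find_size.
  rewrite -(ler_nat R) -/n; lra.
- by rewrite le_min bx yb.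
- have := sum_dist_ge e_sym e_irr e_conn link v.
  rewrite -(ler_nat R) natrD -mulnn !natrM /avg_dist -natr_sum -/n.
  set r : R := (graph_radius e)%:R; set S : R := (\sum_w _)%:R => rS.
  have m0 : 0 < n - 1 by lra.
  rewrite mulrC ler_pdivlMr// /b.
  (* Indeed (n + 1)(n - 1) + 16 (n - 1) + 81 = (n + 8)^2. *)
  have -> : (r - ((n + 1) / 12 + 4 / 3 + 27 / (4 * (n - 1)))) * (n - 1) =
      r * (n - 1) - (n + 8) ^+ 2 / 12 by field; lra.
  (* Expanding this square bounds the right-hand side by 3 r^2 - 9 r, which [rS] bounds by [S]. *)
  have := sqr_ge0 (n + 8 - 6 * r); rewrite !expr2; lra.
Qed.
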